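(* Let $(\mathcal A,\sigma)$ and $(\mathcal B,\varsigma)$ be primitive expansive symbolic substitution systems. Then there exist $K,N\in\mathbb N$ and a regular production system $(\mathcal A_{\mathcal B},L,R)$ equipped with maps $\alpha:\mathcal A_{\mathcal B}\to\mathcal A$, $\beta:\mathcal A_{\mathcal B}\to\mathcal B^*$ and $\delta:\mathcal A_{\mathcal B}\to\{K,K-1\}$ with the following properties: 1. For any orbit $\{(\omega^i,P_i)\}_{i\in\mathbb Z}$ of $(\mathcal A_{\mathcal B},L,R)$, $\{(\alpha(\omega^i),P_i)\}_{i\in\mathbb Z}$ is an orbit of $(\mathcal A,\sigma)$. 2. $\delta(w_i)=\delta(w_j)$ for all $w\in L$ and $1\le i,j\le\|w\|$. (Consequently $\delta$ is well-defined on $L$ and on $L^\infty$, as the common value of $\delta$ on the letters of the word.) 3. For all $w,w'\in L$ with $(w,w')\in R$, $\beta(w')\approx_N\varsigma^{\delta(w)}(\beta(w))$. 4. If the growth rates of $(\mathcal A,\sigma)$ and $(\mathcal B,\varsigma)$ are incommensurate, then no orbit of $(\mathcal A_{\mathcal B},L,R)$ is periodic. 5. $(\mathcal A_{\mathcal B},L,R)$ does have orbits.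
   Context: $\mathbb N=\{1,2,\dots\}$. All alphabets are finite. For an alphabet $\mathcal A$, $\mathcal A^*$ is the set of finite words and $\|w\|$ is the length of $w$, with letters $w_1,\dots,w_{\|w\|}$. For a language $L\subset\mathcal A^*$, $L^\infty\subset\mathcal A^{\mathbb Z}$ is the set of bi-infinite words all of whose finite subwords are subwords of words in $L$. Maps from letters to letters or words are extended to finite words by concatenation, and letterwise maps such as $\alpha$ are extended letterwise to bi-infinite words. A production system $(\mathcal A,L,R)$ consists of an alphabet $\mathcal A$, a language $L\subset\mathcal A^*$ and a finite set $R\subset\mathcal A\times L$ of production rules. It is regular if $L$ is a regular language. $R$ is extended to a relation on words: for finite words $u,v\in L$, $(u,v)\in R$ iff $v=v^1\cdots v^{\|u\|}$ with each $v^i\in L$ and $(u_i,v^i)\in R$. For infinite words $\omega,\tau\in L^\infty$ and a monotonic (nondecreasing) onto function $P:\mathbb Z\to\mathbb Z$, $\omega$ produces $\tau$ with respect to $P$ if $(\omega_i,\tau|_{P^{-1}(i)})\in R$ for every $i\in\mathbb Z$. An orbit of $(\mathcal A,L,R)$ is a family $\{(\omega^i,P_i)\}_{i\in\mathbb Z}$ with $\omega^i\in L^\infty$ and $P_i:\mathbb Z\to\mathbb Z$ monotonic and onto, such that $\omega^i$ produces $\omega^{i+1}$ with respect to $P_i$ for all $i\in\mathbb Z$. It is periodic if there is $\pi\ge1$ with $\omega^i=\omega^{i+\pi}$ and $P_i=P_{i+\pi}$ for all $i$. A production system is expansive if for every sequence $u^1,u^2,\ldots\in L$ with $(u^i,u^{i+1})\in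 R$ there is $n\in\mathbb N$ such that $\|u^i\|>\|u^1\|$ for all $i>n$. A symbolic substitution system $(\mathcal A,\sigma)$, with $\sigma:\mathcal A\to\mathcal A^*$ a function, is the production system $(\mathcal A,\mathcal A^*,\{(a,\sigma(a)):a\in\mathcal A\})$. It is primitive if for some $N$, for all $n>N$ and all $a,b\in\mathcal A$, the letter $b$ occurs in $\sigma^n(a)$. The growth rate of a primitive expansive substitution system on $\{a_1,\dots,a_n\}$ is the Perron–Frobenius eigenvalue $\lambda>1$ of its substitution matrix, whose $(i,j)$ entry is the number of occurrences of $a_i$ in $\sigma(a_j)$. Growth rates $\lambda,\gamma$ are incommensurate if there are no $m,n\in\mathbb N$ with $\lambda^m=\gamma^n$. For $N\in\mathbb N$, $w\approx_N w'$ means there are (possibly empty) words $c,p,p',s,s'$ with $w=pcs$, $w'=p'cs'$ and $N>\|p\|,\|p'\|,\|s\|,\|s'\|$. *)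

(* Defs.v *)
From HB Require Import structures.
From mathcomp Require Import all_boot all_order all_algebra all_field.
From mathcomp Require Import finmap.

Set Implicit Arguments.
Unset Strict Implicit.
Unset Printing Implicit Defensive.

Import Order.TTheory GRing.Theory Num.Theory.
Local Open Scope ring_scope.

(* An alphabet is a [finType] [A], and a bi-infinite word is a function
   [int -> A]. The elements of A^* are the nonempty words of type [seq A]: with
   the empty word in A^*, the constant sequence of empty words would prevent
   every substitution system from being expansive. *)

Definition language (A : Type) := seq A -> Prop.

Record word_map (A B : Type) := WordMap {
  word_of :> A -> seq B;
  word_of_neq0 : forall a, word_of a <> [::]
}.

Definition extend (A B : Type) (f : A -> seq B) (w : seq A) : seq B :=
  flatten [seq f a | a <- w].

Definition regular (A : finType) (L : language A) : Prop :=
  exists (Q : finType) (q0 : Q) (step : Q -> A -> Q) (F : {set Q}),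
    forall w, L w <-> foldl step q0 w \in F.

Definition window (A : Type) (w : int -> A) (i : int) (n : nat) : seq A :=
  mkseq (fun k => w (i + k%:Z)) n.

(* The set L^oo of bi-infinite words. *)
Definition linfty (A : finType) (L : language A) (w : int -> A) : Prop :=
  forall (i : int) (n : nat), exists2 v, L v & infix (window w i n) v.

Record production_system (A : finType) := ProductionSystem {
  lang : language A;
  rules : {fset A * seq A};
  lang_neq0 : forall w, lang w -> w <> [::];
  rules_lang : forall a v, (a, v) \in rules -> lang v
}.

(* The extension of the rules to words; that the factors of [v] lie in the
   language is part of [rules_lang]. *)
Definition rewrites (A : finType) (S : production_system A) (u v : seq A) :
  Prop :=
  [/\ lang S u, lang S v &
      exists2 vs : seq (seq A), v = flatten vs &
        all2 (fun a x => (a, x) \in rules S) u vs].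

Definition monotone_onto (P : int -> int) : Prop :=
  {homo P : x y / x <= y} /\ forall y, exists x, P x = y.

(* For [P] nondecreasing and onto, each fibre of [P] is a finite interval
   [[j, j + n)], so the restriction of [t] to it is [window t j n]. *)
Definition produces (A : finType) (S : production_system A)
    (w t : int -> A) (P : int -> int) : Prop :=
  forall i : int, exists (j : int) (n : nat),
    (forall k, P k = i <-> j <= k < j + n%:Z) /\
    (w i, window t j n) \in rules S.

Definition is_orbit (A : finType) (S : production_system A)
    (w : int -> int -> A) (P : int -> int -> int) : Prop :=
  forall i : int,
    [/\ linfty (lang S) (w i), monotone_onto (P i) &
        produces S (w i) (w (i + 1)) (P i)].

Definition periodic (A : finType) (w : int -> int -> A)
    (P : int -> int -> int) : Prop :=
  exists2 p : nat, (1 <= p)%N &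
    forall i : int, w i =1 w (i + p%:Z) /\ P i =1 P (i + p%:Z).

(* Sequences are indexed from 0, so [u 0] is the initial word u^1. *)
Definition expansive (A : finType) (S : production_system A) : Prop :=
  forall u : nat -> seq A,
    (forall i, rewrites S (u i) (u i.+1)) ->
    exists n : nat, forall i, (n < i)%N -> (size (u 0%N) < size (u i))%N.

Section Substitution.

Variables (A : finType) (sigma : word_map A A).

Lemma substitution_lang a v :
  (a, v) \in [fset (a, sigma a) | a in A]%fset -> v <> [::].
Proof. by case/imfsetP=> b _ [_ ->]; apply: word_of_neq0. Qed.

Definition substitution_system : production_system A :=
  @ProductionSystem A (fun w => w <> [::]) [fset (a, sigma a) | a in A]%fset
    (fun _ h => h) substitution_lang.

Definition primitive : Prop :=
  exists N : nat, forall n, (N < n)%N ->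
    forall a b : A, b \in iter n (extend sigma) [:: a].

Definition substitution_matrix : 'M[algC]_#|A| :=
  \matrix_(i, j) (count_mem (enum_val i) (sigma (enum_val j)))%:R.

(* The Perron-Frobenius eigenvalue is the eigenvalue equal to the spectral
   radius; the condition forces [lambda] to be a nonnegative real and determines
   it uniquely. Eigenvalues of an integer matrix are algebraic, so [algC]
   contains all the complex ones. *)
Definition growth_rate (lambda : algC) : Prop :=
  eigenvalue substitution_matrix lambda /\
  forall mu, eigenvalue substitution_matrix mu -> `|mu| <= lambda.

End Substitution.

Definition incommensurate (lambda gamma : algC) : Prop :=
  ~ exists m n : nat,
      [/\ (1 <= m)%N, (1 <= n)%N & lambda ^+ m = gamma ^+ n].

(* The words [c], [p], [p'], [s], [s'] may be empty. *)
Definition approx (A : Type) (N : nat) (w w' : seq A) : Prop :=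
  exists c p p' s s' : seq A,
    [/\ w = p ++ c ++ s, w' = p' ++ c ++ s' &
        [/\ (size p < N)%N, (size p' < N)%N, (size s < N)%N &
            (size s' < N)%N]].

(* Main.v *)
Require Import Defs.
From HB Require Import structures.
From mathcomp Require Import all_boot all_order all_algebra all_field.
From mathcomp Require Import finmap.
From mathcomp Require Import ring lra zify.

Set Implicit Arguments.
Unset Strict Implicit.
Unset Printing Implicit Defensive.

Import Order.TTheory GRing.Theory Num.Theory.
Local Open Scope ring_scope.

(* Perron-Frobenius left eigenvectors give lengths to the letters, which sigma
   and varsigma multiply by the growth rates lambda and gamma. Lay a row over
   [A] and a row over [B] along the same line and let each letter of [A] carry
   the letters of [B] that start on it. If the row over [A] is produced by
   sigma and the row over [B] by varsigma^d, with [d] chosen in {K, K - 1} so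
   that the ratio of the two scales stays bounded, only boundedly many letters
   of [B] have to be passed across each boundary to restore this rule;
   recording the words passed at both ends of a letter makes all constraints
   local, so the language is regular. Starting from bi-infinite rows cut at
   the origin, which substitution fixes, and from the exponents D_i = min {d |
   lambda^i <= gamma^d}, i in Z, one gets an orbit. Conversely, along an orbit
   of period p the length of the load of a word stays comparable to its own
   length, which grows like lambda^(pn), while up to a bounded error the load
   is multiplied by the same gamma^D at each period, so lambda^p = gamma^D. *)

(** * Perron-Frobenius weights *)

Lemma extend_cat (A B : Type) (f : A -> seq B) u v :
  extend f (u ++ v) = extend f u ++ extend f v.
Proof. by rewrite /extend map_cat flatten_cat. Qed.

Lemma extend_seq1 (A B : Type) (f : A -> seq B) a : extend f [:: a] = f a.
Proof. by rewrite /extend /= cats0. Qed.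

Lemma extend_cons (A B : Type) (f : A -> seq B) a u :
  extend f (a :: u) = f a ++ extend f u.
Proof. by []. Qed.

Lemma iter_extend (A : Type) (f : A -> seq A) n u :
  iter n (extend f) u = extend (fun a => iter n (extend f) [:: a]) u.
Proof.
elim: n u => [|n IHn] u.
  by elim: u => //= a u IHu; rewrite extend_cons -IHu.
rewrite iterS IHn; elim: u => //= a u IHu.
by rewrite !extend_cons extend_cat IHu.
Qed.

Lemma iter_extend_cat (A : Type) (f : A -> seq A) n u v :
  iter n (extend f) (u ++ v) = iter n (extend f) u ++ iter n (extend f) v.
Proof. by rewrite !(iter_extend _ n) extend_cat. Qed.

Lemma bernoulli (R : numDomainType) (t : R) n :
  0 <= t -> 1 + n%:R * t <= (1 + t) ^+ n.
Proof.
move=> t0; elim: n => [|n IHn]; first by rewrite mul0r addr0 expr0.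
rewrite exprS; apply: le_trans (ler_wpM2l _ IHn); last exact: addr_ge0.
have : 0 <= n%:R * t * t by rewrite !mulr_ge0 ?ler0n.
rewrite -subr_ge0 => h; rewrite -subr_ge0; apply: le_trans h _.
by rewrite le_eqVlt -natr1; apply/orP; left; apply/eqP; ring.
Qed.

Lemma pow_unbounded (R : archiNumFieldType) (q C : R) :
  1 < q -> 0 <= C -> exists n, C < q ^+ n.
Proof.
move=> q1 C0; have t0 : 0 < q - 1 by rewrite subr_gt0.
have /archi_boundP: 0 <= C / (q - 1) by rewrite divr_ge0 // ltW.
set n := Num.bound _; rewrite ltr_pdivrMr // => hn; exists n.
rewrite -[q](subrK 1) [_ - 1 + 1]addrC; apply: lt_le_trans (bernoulli _ (ltW
  t0)).
by apply: lt_le_trans hn _; rewrite lerDr.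
Qed.

Lemma le_of_pow_bound (R : archiRealFieldType) (p q C : R) :
  0 <= p -> 0 < q -> (forall n, p ^+ n <= C * q ^+ n) -> p <= q.
Proof.
move=> p0 q0 h; rewrite leNgt; apply/negP => qp.
have C0 : 0 <= C by have := h 0%N; rewrite !expr0 mulr1; apply: le_trans.
have [|n] := @pow_unbounded R (p / q) C _ C0; first by rewrite ltr_pdivlMr //
  mul1r.
by rewrite expr_div_n ltr_pdivlMr ?exprn_gt0 // ltNge h.
Qed.

(** The inverse of 1 plus the sum of the inverses serves as the bound: it makes sense when the order
    is partial, as in [algC], and when [T] is empty. *)
Lemma positive_lower_bound (R : numFieldType) (T : finType) (f : T -> R) :
  (forall a, 0 < f a) -> exists2 c, 0 < c & forall a, c <= f a.
Proof.
move=> f0; pose S := 1 + \sum_a (f a)^-1.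
have S0 : 0 < S by rewrite ltr_pwDl // sumr_ge0 // => a _; rewrite invr_ge0 ltW.
exists S^-1 => [|a]; first by rewrite invr_gt0.
rewrite -[f a]invrK lef_pV2 ?posrE ?invr_gt0 // /S (bigD1 a) //= addrCA lerDl.
by rewrite addr_ge0 // sumr_ge0 // => b _; rewrite invr_ge0 ltW.
Qed.

Lemma upper_bound (R : numDomainType) (T : finType) (f : T -> R) :
  (forall a, 0 <= f a) -> exists2 c, 0 < c & forall a, f a <= c.
Proof.
move=> f0; exists (1 + \sum_a f a) => [|a]; first by rewrite ltr_pwDl //
  sumr_ge0.
rewrite (bigD1 a) //= addrCA lerDl.
by rewrite addr_ge0 // sumr_ge0.
Qed.

(* Peeling off one factor [M - mu] at a time, [z_k = w M^k] satisfies
   [z_(k+1) = mu z_k + f_k] with [f_k = O(r^k)] and [`|mu| <= rho < r]. *)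
Lemma row_power_bound_factors n (M : 'M[algC]_n.+1) (rho r : algC) rs
    (w : 'rV_n.+1) :
  0 <= rho -> rho < r -> (forall mu, mu \in rs -> `|mu| <= rho) ->
  w *m \prod_(mu <- rs) (M - mu%:M) = 0 ->
  exists2 C, 0 <= C & forall k j, `|(w *m M ^+ k) 0 j| <= C * r ^+ k.
Proof.
move=> rho0 rho_r; have r0 := le_lt_trans rho0 rho_r.
elim: rs w => [|mu rs IHrs] w hrs.
  rewrite big_nil mulmx1 => ->; exists 0 => // k j.
  by rewrite mul0mx mxE normr0 mul0r.
rewrite big_cons mulmxA => /IHrs[nu nurs|C' C'0 hC'].
  by apply: hrs; rewrite inE nurs orbT.
have d0 : 0 < r - rho by rewrite subr_gt0.
have W0 : 0 <= \sum_j `|w 0 j| by apply: sumr_ge0.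
exists (\sum_j `|w 0 j| + C' / (r - rho)).
  by rewrite addr_ge0 // divr_ge0 // ltW.
set C := _ + _; have hC : C' <= C * (r - rho).
  by rewrite mulrDl divfK ?gt_eqF // lerDr mulr_ge0 // ltW.
elim=> [|k IHk] j.
  rewrite !expr0 mulmx1 mulr1 /C (bigD1 j) //= -addrA lerDl addr_ge0 //.
    by rewrite sumr_ge0.
  by rewrite divr_ge0 // ltW.
have -> : w *m M ^+ k.+1 = w *m (M - mu%:M) *m M ^+ k + mu *: (w *m M ^+ k).
  rewrite mulmxBr mulmxBl -[w *m M *m _]mulmxA -[M *m _]/(M * _) -exprS.
  by rewrite mul_mx_scalar scalemxAl subrK.
rewrite mxE; apply: le_trans (ler_normD _ _) _;
  rewrite [X in _ + `|X|]mxE normrM.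
have h1 : `|mu| * `|(w *m M ^+ k) 0 j| <= rho * (C * r ^+ k).
  by apply: ler_pM => //; apply: hrs; rewrite inE eqxx.
apply: le_trans (lerD (hC' k j) h1) _.
have : (C' + C * rho) * r ^+ k <= C * r * r ^+ k.
  rewrite ler_wpM2r ?exprn_ge0 ?(ltW r0) // -lerBrDr.
  by apply: le_trans hC _; rewrite mulrBr.
by rewrite exprS [C * (_ * _)]mulrA [rho * _]mulrA [rho * C]mulrC -mulrDl.
Qed.

(** By Cayley-Hamilton the product of [M - mu%:M] over the roots of the characteristic polynomial
    vanishes, so the preceding bound applies to every row [w]. *)
Lemma row_power_bound n (M : 'M[algC]_n) (rho r : algC) (w : 'rV_n) :
  0 <= rho -> rho < r -> (forall mu, eigenvalue M mu -> `|mu| <= rho) ->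
  exists2 C, 0 <= C & forall k j,
    `|iter k (fun u => u *m M) w 0 j| <= C * r ^+ k.
Proof.
case: n M w => [|n] M w rho0 rho_r hM; first by exists 0 => // k [].
have [rs rsE] := closed_field_poly_normal (char_poly M).
rewrite (monicP (char_poly_monic M)) scale1r in rsE.
have hrs mu : mu \in rs -> `|mu| <= rho.
  by move=> mu_rs; apply: hM; rewrite eigenvalue_root_char rsE root_prod_XsubC.
have [|C C0 hC] := @row_power_bound_factors n M rho r rs w rho0 rho_r hrs.
  suff -> : \prod_(mu <- rs) (M - mu%:M) = horner_mx M (char_poly M).
    by rewrite Cayley_Hamilton mulmx0.
  rewrite rsE rmorph_prod; apply: eq_bigr => mu _.
  by rewrite rmorphB /= horner_mx_X horner_mx_C.
exists C => // k j; suff -> : iter k (fun u => u *m M) w = w *m M ^+ k by [].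
elim: k => [|k IHk]; first by rewrite expr0 mulmx1.
by rewrite iterS IHk -mulmxA exprSr.
Qed.

Lemma seq_max_norm (s : seq algC) :
  s != [::] -> exists2 x, x \in s & forall y, y \in s -> `|y| <= `|x|.
Proof.
case: s => // z s _; elim: s z => [|y s IHs] z.
  by exists z => [|y]; rewrite inE // => /eqP->.
have [x xs hx] := IHs y.
have [xz|/ltW zx] := real_leP (normr_real x) (normr_real z).
  exists z => [|u]; first by rewrite inE eqxx.
  by rewrite inE => /predU1P[->//|/hx]; move/le_trans; apply.
exists x => [|u]; first by rewrite inE xs orbT.
by rewrite inE => /predU1P[->//|/hx].
Qed.

Lemma spectral_radius_exists n (M : 'M[algC]_n) : (0 < n)%N ->
  exists2 mu, eigenvalue M mu & forall nu, eigenvalue M nu -> `|nu| <= `|mu|.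
Proof.
move=> n0; have [rs rsE] := closed_field_poly_normal (char_poly M).
rewrite (monicP (char_poly_monic M)) scale1r in rsE.
have [|mu mu_rs hmu] := @seq_max_norm rs.
  apply: contraTneq n0 => rs0; have := size_char_poly M.
  by rewrite rsE rs0 big_nil size_poly1 => -[<-].
have hrs nu : eigenvalue M nu = (nu \in rs).
  by rewrite eigenvalue_root_char rsE root_prod_XsubC.
by exists mu => [|nu]; rewrite hrs //; apply: hmu.
Qed.

Definition weight (R : nmodType) (A : Type) (f : A -> R) (w : seq A) : R :=
  \sum_(a <- w) f a.

Section Weight.

Variables (R : nmodType) (A : Type).
Implicit Types (f : A -> R).

Lemma weight_nil f : weight f [::] = 0. Proof. by rewrite /weight big_nil. Qed.

Lemma weight_cons f a w : weight f (a :: w) = f a + weight f w.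
Proof. by rewrite /weight big_cons. Qed.

Lemma weight_seq1 f a : weight f [:: a] = f a.
Proof. by rewrite /weight big_seq1. Qed.

Lemma weight_cat f u v : weight f (u ++ v) = weight f u + weight f v.
Proof. by rewrite /weight big_cat. Qed.

End Weight.

Lemma weight_extend (R : nmodType) (A B : Type) (g : B -> R) (h : A -> seq B) w
  :
  weight g (extend h w) = weight (fun a => weight g (h a)) w.
Proof.
elim: w => [|a w IHw]; first by rewrite /weight !big_nil.
by rewrite extend_cons weight_cat weight_cons IHw.
Qed.


Lemma weight_scale (R : pzRingType) (A : Type) (f g : A -> R) c w :
  (forall a, f a = c * g a) -> weight f w = c * weight g w.
Proof. by move=> h; rewrite /weight mulr_sumr; apply: eq_bigr. Qed.

Lemma weight_iter (R : pzRingType) (A : Type) (f : A -> R) (s : A -> seq A) c w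
  n :
  (forall a, weight f (s a) = c * f a) ->
  weight f (iter n (extend s) w) = c ^+ n * weight f w.
Proof.
move=> h; elim: n => [|n IHn]; first by rewrite mul1r.
by rewrite iterS weight_extend (weight_scale _ h) IHn mulrA exprS.
Qed.

Section WeightOrder.

Variables (R : numDomainType) (A : Type).
Implicit Types (f g : A -> R).

Lemma weight_le f g w : (forall a, f a <= g a) -> weight f w <= weight g w.
Proof. by move=> h; apply: ler_sum => a _; apply: h. Qed.

Lemma weight_ge0 f w : (forall a, 0 <= f a) -> 0 <= weight f w.
Proof. by move=> h; apply: sumr_ge0 => a _; apply: h. Qed.

Lemma weight_const (c : R) (w : seq A) : weight (fun=> c) w = c * (size w)%:R.
Proof. by rewrite /weight big_const_seq count_predT iter_addr_0 mulr_natr. Qed.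

End WeightOrder.

Lemma weight_gt0 (R : numDomainType) (A : eqType) (f : A -> R) w b :
  (forall a, 0 <= f a) -> b \in w -> 0 < f b -> 0 < weight f w.
Proof.
move=> f0; elim: w => // a w IHw; rewrite inE weight_cons => /predU1P[<-|bw] fb.
  by rewrite ltr_wpDr // weight_ge0.
by rewrite ltr_wpDl // IHw.
Qed.

Section Matrix.

Variables (A : finType) (sigma : word_map A A).

Definition row_of (f : A -> algC) : 'rV[algC]_#|A| := \row_j f (enum_val j).

Lemma row_ofK (v : 'rV_#|A|) : row_of (fun a => v 0 (enum_rank a)) = v.
Proof. by apply/rowP=> j; rewrite mxE enum_valK. Qed.

Lemma weight_count (f : A -> algC) w :
  weight f w = \sum_b f b * (count_mem b w)%:R.
Proof.
elim: w => [|a w IHw]; first by rewrite weight_nil big1 // => b _;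
  rewrite mulr0.
rewrite weight_cons IHw (bigD1 a) //= [RHS](bigD1 a) //= eqxx natrD mulrDr
  mulr1.
rewrite addrA; congr (_ + _); apply: eq_bigr => b /negPf ba.
by rewrite eq_sym ba.
Qed.

Lemma row_of_mul (f : A -> algC) :
  row_of f *m substitution_matrix sigma = row_of (fun a => weight f (sigma a)).
Proof.
apply/rowP=> j; rewrite !mxE weight_count [RHS](reindex (fun i : 'I_#|A| =>
  enum_val i)).
  by apply: eq_bigr => i _; rewrite !mxE.
exact/onW_bij/enum_val_bij.
Qed.

(** The row of the weights of sigma^k(a), for [a] in [A], is [row_of f] times the k-th power of the
    substitution matrix, so [row_power_bound] applies. *)
Lemma weight_growth (rho r : algC) (f : A -> algC) :
  0 <= rho -> rho < r ->
  (forall mu, eigenvalue (substitution_matrix sigma) mu -> `|mu| <= rho) ->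
  exists2 C, 0 <= C & forall k a,
    `|weight f (iter k (extend sigma) [:: a])| <= C * r ^+ k.
Proof.
move=> rho0 rho_r hM.
have [C C0 hC] := row_power_bound (row_of f) rho0 rho_r hM; exists C => // k a.
have := hC k (enum_rank a).
suff -> : iter k (mulmx^~ (substitution_matrix sigma)) (row_of f) =
          row_of (fun a => weight f (iter k (extend sigma) [:: a])).
  by rewrite mxE enum_rankK.
elim: k => [|k IHk]; first by apply/rowP=> j; rewrite !mxE weight_seq1.
rewrite iterS IHk row_of_mul; apply/rowP=> j; rewrite !mxE.
by rewrite iterSr extend_seq1 [in RHS]iter_extend weight_extend.
Qed.

End Matrix.

Lemma size_extend_ge (A B : Type) (f : word_map A B) (u : seq A) :
  (size u <= size (extend f u))%N.
Proof.
elim: u => // a u IHu; rewrite extend_cons size_cat /= -add1n leq_add //.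
by case: (f a) (@word_of_neq0 _ _ f a).
Qed.

Section PerronFrobenius.

Variables (A : finType) (sigma : word_map A A).
Hypotheses (hA : (0 < #|A|)%N) (sigma_prim : primitive sigma).

(* If [|v| M >= rho |v|] were not an equality, applying a positive power of [M]
   would give a positive [y] with [y M >= (rho + eps) y], whose iterates grow
   faster than the spectral radius [rho] allows. *)
Lemma perron_frobenius_algC : exists (rho : algC) (x : A -> algC),
  [/\ 0 < rho, forall a, 0 < x a, forall a, weight x (sigma a) = rho * x a &
      forall mu, eigenvalue (substitution_matrix sigma) mu -> `|mu| <= rho].
Proof.
have [N hN] := sigma_prim; pose M := substitution_matrix sigma.
have [mu /eigenvalueP[v vM v0] mumax] := spectral_radius_exists M hA.
pose rho := `|mu|; pose x a := `|v 0 (enum_rank a)|.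
have rho0 : 0 <= rho by apply: normr_ge0.
have x0 a : 0 <= x a by apply: normr_ge0.
have [a0 xa0] : exists a, 0 < x a.
  have [j vj] : exists j, v 0 j != 0.
    apply/existsP; apply: contraNT v0; rewrite negb_exists => /forallP h.
    by apply/eqP/rowP=> j; rewrite mxE; apply/eqP; have := h j; rewrite negbK.
  by exists (enum_val j); rewrite /x enum_valK normr_gt0.
have xM a : rho * x a <= weight x (sigma a).
  have := congr1 (fun u : 'rV_#|A| => u 0 (enum_rank a)) vM.
  rewrite -[in LHS](row_ofK v) row_of_mul !mxE enum_rankK => va.
  by rewrite /rho /x -normrM -va; apply: ler_norm_sum.
have itN f a : weight f (iter N.+1 (extend sigma) (sigma a)) =
    weight (fun b => weight f (iter N.+1 (extend sigma) [:: b])) (sigma a).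
  by rewrite iter_extend weight_extend.
have eqx a : weight x (sigma a) = rho * x a.
  apply/eqP; rewrite -subr_eq0; apply/negPn/negP => da.
  pose d b := weight x (sigma b) - rho * x b.
  have d0 b : 0 <= d b by rewrite subr_ge0.
  have {da} da : 0 < d a by rewrite lt_def da d0.
  pose y b := weight x (iter N.+1 (extend sigma) [:: b]).
  have y0 b : 0 < y b by apply: weight_gt0 xa0 => //; apply: hN.
  (* With y = x M^(N+1), the difference y M - rho y equals d M^(N+1); it is positive because
     sigma^(N+1)(b) contains the letter [a], where [d] is positive. *)
  have yM b : 0 < weight y (sigma b) - rho * y b.
    have -> : weight y (sigma b) - rho * y b =
              weight d (iter N.+1 (extend sigma) [:: b]).
      rewrite -itN -[sigma b]extend_seq1 -iterSr iterS weight_extend /y /weight.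
      by rewrite mulr_sumr -sumrB.
    by apply: weight_gt0 da => //; apply: hN.
  have [|eps eps0 heps] := @positive_lower_bound _ _
      (fun b => (weight y (sigma b) - rho * y b) / y b).
    by move=> b; rewrite divr_gt0.
  have {}heps b : (rho + eps) * y b <= weight y (sigma b).
    by rewrite mulrDl -lerBrDl -ler_pdivlMr.
  have re0 : 0 < rho + eps by rewrite ltr_wpDl.
  have powy k b :
      (rho + eps) ^+ k * y b <= weight y (iter k (extend sigma) [:: b]).
    elim: k b => [|k IHk] b; first by rewrite mul1r weight_seq1.
    rewrite iterSr extend_seq1 iter_extend weight_extend.
    apply: le_trans (weight_le _ IHk).
    rewrite (@weight_scale _ _ _ y ((rho + eps) ^+ k)) //.
    by rewrite exprSr -mulrA ler_wpM2l // exprn_ge0 // ltW.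
  (* Strictly between [rho] and [rho + eps]: by [weight_growth] the weights of [y] are bounded by a
     multiple of r^k, which contradicts [powy]. *)
  pose r := rho + eps / 2%:R.
  have e2 : 0 < eps / 2%:R by rewrite divr_gt0 // ltr0n.
  have rho_r : rho < r by rewrite ltrDl.
  have r0 := le_lt_trans rho0 rho_r.
  have [C C0 hC] := weight_growth y rho0 rho_r mumax.
  have [||k] := @pow_unbounded _ ((rho + eps) / r) (C / y a).
  - rewrite ltr_pdivlMr // mul1r /r ltrD2l ltr_pdivrMr ?ltr0n //.
    by rewrite mulr_natr mulr2n ltrDl.
  - by rewrite divr_ge0 // ltW.
  rewrite expr_div_n ltr_pdivlMr ?exprn_gt0 // mulrAC ltr_pdivrMr //.
  move/lt_le_trans/(_ (powy k a)); have := hC k a.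
  rewrite ger0_norm; first by move=> h1 h2; have := lt_le_trans h2 h1;
    rewrite ltxx.
  by apply: weight_ge0 => b; apply: ltW.
have eqN a : weight x (iter N.+1 (extend sigma) [:: a]) = rho ^+ N.+1 * x a.
  by rewrite (weight_iter _ _ eqx) weight_seq1.
have posN a : 0 < rho ^+ N.+1 * x a.
  by rewrite -eqN; apply: weight_gt0 xa0 => //; apply: hN.
exists rho, x; split=> // [|a].
  rewrite lt_def rho0 andbT; apply/eqP => r0.
  by have := posN a0; rewrite r0 expr0n mul0r ltxx.
rewrite lt_def x0 andbT; apply/eqP => xa.
by have := posN a; rewrite xa mulr0 ltxx.
Qed.

Hypothesis sigma_exp : expansive (substitution_system sigma).

Lemma size_iter_mono n m (u : seq A) : (n <= m)%N ->
  (size (iter n (extend sigma) u) <= size (iter m (extend sigma) u))%N.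
Proof.
move/subnKC <-; elim: (m - n)%N => [|k IHk]; first by rewrite addn0.
by rewrite addnS iterS; apply: leq_trans (size_extend_ge _ _).
Qed.

Lemma iter_rewrites n a : rewrites (substitution_system sigma)
  (iter n (extend sigma) [:: a]) (iter n.+1 (extend sigma) [:: a]).
Proof.
have nz k : iter k (extend sigma) [:: a] <> [::].
  by move/(congr1 size)/eqP; rewrite -leqn0 leqNgt (size_iter_mono [:: a] (leq0n
    k)).
split; [exact: (nz n)|exact: (nz n.+1)|].
exists [seq sigma b | b <- iter n (extend sigma) [:: a]] => //.
elim: (iter n _ _) => //= b u ->; rewrite andbT.
by apply/imfsetP; exists b.
Qed.

(** Expansiveness gives each letter an iterate of length at least 2, and finiteness a common
    exponent [n]; each further [n] iterations then lengthen the word by at least one letter. *)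
Lemma size_iter_unbounded : exists n, forall m a,
  (m <= size (iter (m * n) (extend sigma) [:: a]))%N.
Proof.
have [n hn] : exists n, forall a, (2 <= size (iter n (extend sigma) [:: a]))%N.
  have /fin_all_exists[f hf] : forall a, exists n,
      (2 <= size (iter n (extend sigma) [:: a]))%N.
    move=> a; have [n hn] := sigma_exp (fun n => iter_rewrites n a).
    by exists n.+1; have := hn n.+1 (ltnSn n).
  exists (\max_a f a) => a; apply: leq_trans (hf a) _.
  by apply: size_iter_mono; apply: leq_bigmax.
exists n; elim=> [|m IHm] a //.
rewrite mulSn addnC iterD iter_extend.
case: (iter n _ _) (hn a) => [|b [|c w]] //= _.
rewrite !extend_cons !size_cat -addn1 addnA; apply: leq_trans (leq_addr _ _).
by apply: leq_add => //; apply: leq_trans (size_iter_mono [:: c] (leq0n _)).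
Qed.

(** If [lambda] were at most 1, the weights of the iterates of a letter would stay bounded while
    their sizes do not. A growth rate equals [lambda] since both are eigenvalues of largest modulus.
    The values are moved from [algC] to [algR], whose order is total. *)
Lemma perron_frobenius : exists (lambda : algR) (l : A -> algR),
  [/\ 1 < lambda, forall a, 0 < l a,
      forall a, weight l (sigma a) = lambda * l a &
      forall mu, growth_rate sigma mu -> mu = algRval lambda].
Proof.
have [rho [x [rho0 x0 xM rhomax]]] := perron_frobenius_algC.
pose lam := in_algR (gtr0_real rho0); pose l a := in_algR (gtr0_real (x0 a)).
have l0 a : 0 < l a by apply: x0.
have lM a : weight l (sigma a) = lam * l a.
  by apply/val_inj; rewrite /= rmorph_sum /= -xM.
exists lam, l; split=> //.
  have [c c0 hc] := positive_lower_bound l0.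
  have /card_gt0P[a _] := hA; rewrite ltNge; apply/negP => lam1.
  have /archi_boundP : 0 <= l a / c by rewrite divr_ge0 // ltW.
  set m := Num.bound _; have [n /(_ m) hn] := size_iter_unbounded.
  rewrite ltr_pdivrMr //; apply/negP; rewrite -leNgt mulrC.
  have : weight l (iter (m * n) (extend sigma) [:: a]) <= l a.
    rewrite (weight_iter _ _ lM) weight_seq1 -[leRHS]mul1r.
    rewrite ler_wpM2r ?(ltW (l0 a)) //.
    by rewrite exprn_ile1 // ltW.
  apply: le_trans; apply: le_trans (weight_le _ hc).
  by rewrite weight_const ler_wpM2l ?ler_nat ?(ltW c0).
move=> mu [mu_eig mumax]; apply/le_anti/andP; split.
  have /ger0_norm <- := le_trans (normr_ge0 mu) (mumax mu mu_eig).
  exact: rhomax.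
rewrite -[algRval _]ger0_norm ?(ltW rho0) //; apply: mumax.
apply/eigenvalueP; exists (row_of x); last first.
  apply/eqP => /rowP h; have /card_gt0P[a _] := hA.
  by have := h (enum_rank a); rewrite !mxE => /eqP; rewrite gt_eqF.
by rewrite row_of_mul; apply/rowP=> j; rewrite !mxE xM.
Qed.

End PerronFrobenius.

(** * Bi-infinite rows *)

Section Window.

Variables (A B : Type).
Implicit Types (w : int -> A) (i : int) (m n : nat).

Lemma size_window w i n : size (window w i n) = n.
Proof. by rewrite size_mkseq. Qed.

Lemma nth_window x w i n k : (k < n)%N -> nth x (window w i n) k = w (i + k%:Z).
Proof. exact: nth_mkseq. Qed.

Lemma window1 w i : window w i 1 = [:: w i].
Proof. by rewrite /window /mkseq /= addr0. Qed.

Lemma window_add w i m n :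
  window w i (m + n) = window w i m ++ window w (i + m%:Z) n.
Proof.
rewrite /window /mkseq iotaD map_cat add0n; congr (_ ++ _).
rewrite -[m in iota m]addn0 iotaDl -map_comp; apply: eq_map => k /=.
by rewrite PoszD addrA.
Qed.

Lemma windowSr w i n : window w i n.+1 = rcons (window w i n) (w (i + n%:Z)).
Proof. by rewrite -addn1 window_add window1 cats1. Qed.

Lemma windowS w i n : window w i n.+1 = w i :: window w (i + 1) n.
Proof. by rewrite -add1n window_add window1. Qed.

Lemma map_window (f : A -> B) w i n :
  map f (window w i n) = window (fun k => f (w k)) i n.
Proof. by rewrite /window -map_comp. Qed.

Lemma window_nneg w (r : nat -> A) m n : (forall k, w (Posz k) = r k) ->
  window w m n = drop m (mkseq r (m + n)).
Proof.
move=> h; apply: (@eq_from_nth _ (w 0)) => [|k].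
  by rewrite size_window size_drop size_mkseq addKn.
rewrite size_window => kn; rewrite nth_window // nth_drop nth_mkseq ?ltn_add2l
  //.
by rewrite -PoszD h.
Qed.

(** [Negz k] is -(k + 1), so [l] lists the left half outwards from the origin and a window reads it
    backwards. *)
Lemma window_neg w (l : nat -> A) m n : (forall k, w (Negz k) = l k) ->
  window w (- (m + n)%:Z) n = rev (drop m (mkseq l (m + n))).
Proof.
move=> h; apply: (@eq_from_nth _ (w 0)) => [|k].
  by rewrite size_window size_rev size_drop size_mkseq addKn.
rewrite size_window => kn; rewrite nth_window // nth_rev size_drop size_mkseq
  addKn //.
rewrite nth_drop nth_mkseq; last by lia.
by rewrite -h; congr (w _); lia.
Qed.

End Window.

(* The block [f (w k)] occupies the indices [[a k, a (k + 1))] of [w']. *)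
Definition inflates (A B : Type) (f : A -> seq B) (w : int -> A) (w' : int -> B)
    (a : int -> int) : Prop :=
  a 0 = 0 /\ forall k,
    a (k + 1) = a k + (size (f (w k)))%:Z /\
    window w' (a k) (size (f (w k))) = f (w k).

Lemma inflates_window (A B : Type) (f : A -> seq B) w w' a k n :
  inflates f w w' a ->
  a (k + n%:Z) = a k + (size (extend f (window w k n)))%:Z /\
  window w' (a k) (size (extend f (window w k n))) = extend f (window w k n).
Proof.
case=> _ h; elim: n => [|n [IHa IHw]]; first by rewrite !addr0.
have [ha hw] := h (k + n%:Z).
rewrite windowSr -cats1 extend_cat extend_seq1 size_cat; split.
  by rewrite -addn1 PoszD addrA ha IHa PoszD addrA.
by rewrite window_add IHw -IHa hw.
Qed.

Lemma inflates_id (A : Type) (w : int -> A) : inflates (fun a => [:: a]) w w id.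
Proof. by split=> // k; rewrite window1. Qed.

Lemma inflates_comp (A B C : Type) (f : A -> seq B) (g : B -> seq C) w w' w'' a
  b :
  inflates f w w' a -> inflates g w' w'' b ->
  inflates (fun x => extend g (f x)) w w'' (fun k => b (a k)).
Proof.
move=> [a0 ha] hb; split=> [|k]; first by rewrite a0 hb.1.
have [-> hw] := ha k; have := inflates_window (a k) (size (f (w k))) hb.
by rewrite hw.
Qed.

Section HalfRows.

Variables (A : finType) (sigma : word_map A A).
Hypothesis hA : (0 < #|A|)%N.
Hypothesis sigma_exp : expansive (substitution_system sigma).

(** [f] need not be invertible, but its iterates from [a] run into a cycle. There [p.+1] iterations
    are the identity, so [p] iterations undo one step and extend the orbit to negative times. *)
Lemma bi_infinite_orbit (f : A -> A) :
  exists s : int -> A, forall i, s (i + 1) = f (s i).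
Proof.
have /card_gt0P[a _] := hA.
have /trajectP[i i_lt iE] := looping_order f a.
pose c := iter i f a; pose p := (order f a - i.+1)%N.
have pE : iter p.+1 f c = c.
  by rewrite -iterD -[RHS]iE; congr (iter _ f a); rewrite /p; lia.
exists (fun j => match j with
  | Posz n => iter n f c | Negz n => iter (p * n.+1) f c end).
case=> [n|[|n]]; first by rewrite -PoszD addn1.
  by rewrite /= muln1 -iterS pE.
have -> : Negz n.+1 + 1 = Negz n by lia.
by rewrite -iterS [(p * n.+2)%N]mulnS -addSn addnC iterD pE.
Qed.

(* Since [s (i + 1)] is the first letter of [sigma (s i)], the words
   [sigma^n (s (i - n))] are prefixes of each other and converge to [W i]. *)
Lemma half_rows : exists W : int -> nat -> A, forall i k,
  mkseq (W (i + 1)) (size (extend sigma (mkseq (W i) k))) =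
  extend sigma (mkseq (W i) k).
Proof.
have [s hs] := bi_infinite_orbit (fun a => head a (sigma a)).
have [g hg] := size_iter_unbounded sigma_exp.
pose u i n := iter n (extend sigma) [:: s (i - n%:Z)].
have uS i n : exists t, u i n.+1 = u i n ++ t.
  rewrite /u iterSr extend_seq1.
  have := hs (i - n.+1%:Z); have -> : i - n.+1%:Z + 1 = i - n%:Z by lia.
  move=> ->; case: (sigma _) (@word_of_neq0 _ _ sigma (s (i - n.+1%:Z))) => // b
    v _.
  by rewrite /= -cat1s iter_extend_cat; eexists.
have u_le i n m : (n <= m)%N -> exists t, u i m = u i n ++ t.
  move/subnKC <-; elim: (m - n)%N => [|k [t IHk]].
    by exists [::]; rewrite addn0 cats0.
  have [t' tE] := uS i (n + k)%N; rewrite addnS tE IHk.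
  by exists (t ++ t'); rewrite catA.
have u_nth i n m k : (k < size (u i n))%N -> (k < size (u i m))%N ->
    nth (s 0) (u i n) k = nth (s 0) (u i m) k.
  move=> kn km; have [/(u_le i)[t mE]|/ltnW/(u_le i)[t nE]] := leqP n m.
    by rewrite mE nth_cat kn.
  by rewrite nE nth_cat km.
(* By [hg] this iterate has more than [k] letters, so the default letter is never read. *)
pose W i k := nth (s 0) (u i (k.+1 * g)%N) k.
have WE i n : mkseq (W i) (size (u i n)) = u i n.
  apply: (@eq_from_nth _ (s 0)) => [|k]; rewrite size_mkseq // => kn.
  by rewrite nth_mkseq //; apply: u_nth => //; apply: hg.
have Wtake i n k : (k <= size (u i n))%N -> mkseq (W i) k = take k (u i n).
  by move=> kn; rewrite -WE /mkseq -map_take take_iota (minn_idPl kn).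
exists W => i k; have hk := hg k (s (i - (k * g)%N%:Z)).
have uE : u (i + 1) (k * g).+1 = extend sigma (u i (k * g)%N).
  by rewrite /u iterS; congr (extend _ (iter _ _ [:: s _])); lia.
rewrite (Wtake i (k * g)%N k hk).
have {uE} : u (i + 1) (k * g).+1 = extend sigma (take k (u i (k * g)%N)) ++
    extend sigma (drop k (u i (k * g)%N)).
  by rewrite uE -extend_cat cat_take_drop.
set x := extend sigma (take _ _) => uE.
rewrite (Wtake (i + 1) (k * g).+1 (size x)) ?uE ?take_size_cat //.
by rewrite size_cat leq_addr.
Qed.

End HalfRows.

Section Rows.

Variables (A : finType) (sigma : word_map A A).
Hypothesis hA : (0 < #|A|)%N.
Hypothesis sigma_exp : expansive (substitution_system sigma).

Lemma rev_word_of_neq0 a : rev (sigma a) <> [::].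
Proof.
by move/(congr1 rev); rewrite revK; apply: word_of_neq0.
Qed.

Definition rev_word_map : word_map A A := WordMap rev_word_of_neq0.

(** Reversing every word turns a derivation of the mirrored substitution into one of [sigma] with
    the same lengths. Thus [half_rows] also yields left halves of rows. *)
Lemma rev_expansive : expansive (substitution_system rev_word_map).
Proof.
move=> u hu; have [|n hn] := sigma_exp (u := fun i => rev (u i)) _.
  move=> i; have [ui uSi [vs vsE hvs]] := hu i; split.
  - by move/(congr1 rev); rewrite revK.
  - by move/(congr1 rev); rewrite revK.
  exists (rev (map rev vs)).
    rewrite vsE; elim: vs {vsE hvs} => // v vs IHvs /=.
    by rewrite rev_cat IHvs rev_cons -cats1 flatten_cat /= cats0.
  rewrite all2E size_rev size_rev size_map; move: hvs;
    rewrite all2E => /andP[sz h].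
  rewrite sz /= -rev_zip ?size_map ?(eqP sz) // all_rev.
  move: h; elim: (u i) (vs) => [|a us IHus] [|v vs'] //= /andP[hv /IHus ->].
  rewrite andbT; case/imfsetP: hv => b _ [-> ->].
  by apply/imfsetP; exists b; rewrite //= revK.
by exists n => i /hn; rewrite !size_rev.
Qed.

(** Half-rows of [sigma] and reversed half-rows of the mirrored substitution are glued at the
    origin, which is a block boundary at every step. The halves may be chosen independently, as all
    nonempty words are allowed. *)
Lemma rows_exist : exists (w : int -> int -> A) (a : int -> int -> int),
  forall i, inflates sigma (w i) (w (i + 1)) (a i).
Proof.
have [r hr] := half_rows hA sigma_exp.
have [l hl] := half_rows hA rev_expansive.
pose w i k := match k with Posz n => r i n | Negz n => l i n end.
pose b i n := size (extend rev_word_map (mkseq (l i) n)).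
pose a i k := match k with
  | Posz n => (size (extend sigma (mkseq (r i) n)))%:Z
  | Negz n => - (b i n.+1)%:Z end.
have aN i n : a i (- n%:Z) = - (b i n)%:Z by case: n.
exists w, a => i; split=> // -[n|n].
  rewrite -PoszD addn1 /= mkseqS -cats1 extend_cat extend_seq1 size_cat PoszD.
  split=> //; rewrite (window_nneg (r := r (i + 1))) //.
  have := hr i n.+1; rewrite mkseqS -cats1 extend_cat extend_seq1 size_cat =>
    ->.
  by rewrite drop_size_cat.
have -> : Negz n + 1 = - n%:Z by lia.
have bS : b i n.+1 = (b i n + size (sigma (l i n)))%N.
  by rewrite /b mkseqS -cats1 extend_cat extend_seq1 size_cat size_rev.
rewrite aN /= bS; split; first by lia.
rewrite (window_neg (l := l (i + 1))) //.
have := hl i n.+1; rewrite -/(b _ _) bS => ->.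
by rewrite mkseqS -cats1 extend_cat extend_seq1 drop_size_cat // revK.
Qed.

End Rows.

(** * The production system *)

Section PopulatedSystem.

Variables (A B : finType) (sigma : word_map A A) (varsigma : word_map B B).
Variables K C N : nat.

(* A letter is a letter of [A] carrying a nonempty word [b :: s] over [B], a bit
   selecting the exponent [K] or [K - 1], and the words over [B] that cross its
   left and right boundaries, from left to right, in the next production. *)
Definition letter : finType :=
  (A * (B * C.-bseq B) * bool * (N.-bseq B * N.-bseq B))%type.

Implicit Types (x y : letter) (u v w : seq letter).

Definition base x : A := x.1.1.1.
Definition load x : seq B := x.1.1.2.1 :: x.1.1.2.2.
Definition exponent x : nat := if x.1.2 then K else (K - 1)%N.
Definition inflow x : N.-bseq B := x.2.1.
Definition outflow x : N.-bseq B := x.2.2.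

Lemma load_neq0 x : load x <> [::]. Proof. by []. Qed.

Definition load_map : word_map letter B := WordMap load_neq0.

(** Equal flows let the rules of neighbours telescope; equal bits make the exponent constant along a
    word. *)
Definition compatible : rel letter :=
  fun x y => (outflow x == inflow y) && (x.1.2 == y.1.2).

Definition populated_lang : language letter :=
  fun w => (w != [::]) && sorted compatible w.

(** The last condition conserves the letters of [B]: the word received from the left precedes the
    image of the load, and the word passed on to the right is cut off the end. *)
Definition populated_rule x v : bool :=
  [&& v != [::], sorted compatible v, map base v == sigma (base x) &
      extend load v ++ outflow x ==
      inflow x ++ iter (exponent x) (extend varsigma) (load x)].

(** Words of bounded length form a finite type, which makes this a finite set; the bound excludes no
    rule, since [v] is as long as [sigma (base x)]. *)
Definition populated_rules : {fset letter * seq letter} :=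
  [fset (z.1, bseqval z.2) | z in
     [pred z : letter * (\max_a size (sigma a)).-bseq letter
      | populated_rule z.1 z.2]]%fset.

Lemma populated_rulesP x v :
  reflect (populated_rule x v) ((x, v) \in populated_rules).
Proof.
apply: (iffP idP) => [/imfsetP[z /= hz [-> ->]] // | xv].
have vs : (size v <= \max_a size (sigma a))%N.
  have /and4P[_ _ /eqP/(congr1 size) + _] := xv; rewrite size_map => ->.
  exact: leq_bigmax.
by apply/imfsetP; exists (x, Bseq vs).
Qed.

Lemma populated_lang_neq0 w : populated_lang w -> w <> [::].
Proof. by case/andP => /eqP. Qed.

Lemma populated_rules_lang x v :
  (x, v) \in populated_rules -> populated_lang v.
Proof. by move/populated_rulesP/and4P=> [v0 vs _ _]; apply/andP. Qed.

Definition populated_system : production_system letter :=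
  ProductionSystem populated_lang_neq0 populated_rules_lang.

(* The states are the start [None], the sink [Some None] and the last letter
   read [Some (Some x)]. *)
Lemma populated_regular : regular (lang populated_system).
Proof.
pose step (q : option (option letter)) y := match q with
  | None => Some (Some y)
  | Some None => Some None
  | Some (Some x) => if compatible x y then Some (Some y) else Some None end.
exists _, None, step, [set q | if q is Some (Some _) then true else false].
move=> w; rewrite inE.
have sinkE v : foldl step (Some None) v = Some None by elim: v.
suff -> : (if foldl step None w is Some (Some _) then true else false) =
          (w != [::]) && sorted compatible w by [].
case: w => // x w /=; elim: w x => //= y w IHw x.
by case: ifP => _ //; rewrite sinkE.
Qed.

Lemma exponent_const w x y :
  populated_lang w -> x \in w -> y \in w -> exponent x = exponent y.
Proof.
case/andP=> _; case: w => // z w /= zw.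
suff h t : t \in z :: w -> t.1.2 = z.1.2 by move=> /h xz /h yz;
  rewrite /exponent xz yz.
elim: w z zw t => [|s w IHw] z /=; first by move=> _ t; rewrite inE => /eqP->.
case/andP=> /andP[_ /eqP zs] /IHw h t; rewrite inE => /predU1P[-> //|/h ->].
by rewrite zs.
Qed.

(* What flows out of a letter flows into its right neighbour, so the rules of
   the letters of a word add up to a rule for the word. *)
Lemma load_flatten x u vs :
  path compatible x u -> all2 populated_rule (x :: u) vs ->
  extend load (flatten vs) ++ outflow (last x u) =
  inflow x ++ iter (exponent x) (extend varsigma) (extend load (x :: u)).
Proof.
elim: u x vs => [|y u IHu] x [|v vs] //=.
  move=> _; case: vs => [|? ?]; last by rewrite andbF.
  rewrite andbT => /and4P[_ _ _ /eqP].
  by rewrite /= cats0 extend_seq1.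
case/andP=> /andP[/eqP xy /eqP bxy] yu /andP[/and4P[_ _ _ /eqP xv] hvs].
rewrite extend_cat -catA (IHu y vs yu hvs) -xy catA xv.
rewrite [extend load (x :: _)]extend_cons iter_extend_cat catA.
by rewrite {2}/exponent -bxy.
Qed.

(** If [q] is no longer than [v], the common factor is [v] without its suffix [q]. Otherwise [u] is
    shorter than [p], and the empty common factor will do. *)
Lemma approx_of_shift n (T : eqType) (u v p q : seq T) :
  (size p < n)%N -> (size q < n)%N -> u ++ q = p ++ v -> approx n u v.
Proof.
move=> pn qn uv; have n0 := leq_ltn_trans (leq0n _) pn.
have [qv|vq] := leqP (size q) (size v).
  pose k := (size v - size q)%N; have := congr1 size uv;
    rewrite !size_cat => sz.
  have su : size u = (size p + k)%N by rewrite /k; lia.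
  have uE : u = p ++ take k v.
    by rewrite -(take_size_cat q (erefl (size u))) uv su take_cat ltnNge
      leq_addr addKn.
  have qE : q = drop k v.
    by rewrite -(drop_size_cat q (erefl (size u))) uv su drop_cat ltnNge
      leq_addr addKn.
  exists (take k v), p, [::], [::], q; split=> //; first by rewrite cats0.
  by rewrite qE /= cat_take_drop.
exists [::], u, v, [::], [::]; rewrite /= !cats0; split=> //; split=> //.
  by have := congr1 size uv; rewrite !size_cat; lia.
exact: ltn_trans qn.
Qed.

Lemma populated_approx u v : rewrites populated_system u v ->
  forall x, x \in u ->
    approx N.+1 (extend load v)
      (iter (exponent x) (extend varsigma) (extend load u)).
Proof.
case=> hu _ [vs -> hvs] x xu; have [_ us] := andP hu.
case: u hu hvs xu us => // y u hu hvs xu /= us.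
have {}hvs : all2 populated_rule (y :: u) vs.
  move: hvs; rewrite !all2E => /andP[-> /=]; apply: sub_all => -[t v' /=].
  by move/populated_rulesP.
rewrite (exponent_const hu xu (mem_head y u)).
(* Flows have at most [N] letters while [approx] bounds strictly, whence [N.+1]. *)
apply: approx_of_shift (load_flatten us hvs); rewrite ltnS size_bseq //.
Qed.

Lemma populated_orbit_base (w : int -> int -> letter) P : is_orbit
  populated_system w P ->
  is_orbit (substitution_system sigma) (fun i j => base (w i j)) P.
Proof.
move=> h i; have [_ hP hprod] := h i; split=> //.
  by move=> j n; exists (window (fun k => base (w i k)) j n.+1);
    rewrite // windowSr -cats1 prefix_infix ?prefix_prefix.
move=> k; have [j [n [hj /populated_rulesP/and4P[_ _ /eqP hb _]]]] := hprod k.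
exists j, n; split=> //; apply/imfsetP; exists (base (w i k)) => //.
by rewrite -hb map_window.
Qed.

End PopulatedSystem.

(** * Periodic orbits *)

Lemma int_const (T : Type) (f : int -> T) :
  (forall k, f (k + 1) = f k) -> forall k, f k = f 0.
Proof.
move=> h; case=> n; first by elim: n => // n <-; rewrite -[n.+1]addn1 PoszD h.
elim: n => [|n IHn]; first by rewrite -h.
by rewrite -IHn -h; congr f; lia.
Qed.

(* If [g < p], compare with an intermediate factor [q > 1], for which the
   bounded error is absorbed even when [g = 1]. *)
Lemma growth_factors_eq (R : archiRealFieldType) (Q : R -> R -> Prop)
    (p g c k1 k2 : R) :
  1 < p -> 1 <= g -> 0 <= c -> 0 < k1 ->
  (forall L E, Q L E -> [/\ 0 < L, k1 * L <= E & E <= k2 * L]) ->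
  (forall L E, Q L E -> exists E',
     [/\ Q (p * L) E', g * E - c <= E' & E' <= g * E + c]) ->
  (forall b, exists L E, Q L E /\ b < E) ->
  p = g.
Proof.
move=> p1 g1 c0 k10 hQ hstep hbig.
have p0 : 0 <= p by lra.
have pg : p <= g.
  rewrite leNgt; apply/negP => gp.
  pose q := (p + g) / 2%:R; have q1 : 1 < q by rewrite /q; lra.
  have qp : q < p by rewrite /q; lra.
  have gq : g <= q by rewrite /q; lra.
  (* Chosen so that q E + c + d = q (E + d): the shift by [d] absorbs the error. *)
  pose d := c / (q - 1); have dq : d * (q - 1) = c by rewrite divfK // subr_eq0
    gt_eqF.
  have d0 : 0 <= d by rewrite divr_ge0 // subr_ge0 ltW.
  have [L [E [QLE _]]] := hbig 0; have [L0 kE _] := hQ _ _ QLE.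
  have it n : exists2 E', Q (p ^+ n * L) E' & E' + d <= q ^+ n * (E + d).
    elim: n => [|n [E' QE' hE']]; first by exists E; rewrite !mul1r.
    have [E'' [QE'' _ hE'']] := hstep _ _ QE'.
    exists E''; first by rewrite exprS -mulrA.
    rewrite exprS -mulrA; apply: le_trans (ler_wpM2l _ hE'); last by lra.
    have [L'0 kE' _] := hQ _ _ QE'.
    have E'0 : 0 <= E' by apply: le_trans kE'; rewrite mulr_ge0 // ltW.
    have : g * E' <= q * E' by rewrite ler_wpM2r.
    by lra.
  suff : p <= q by rewrite leNgt qp.
  apply: (@le_of_pow_bound _ _ _ ((E + d) / (k1 * L))) => // [|n]; first lra.
  rewrite mulrAC ler_pdivlMr ?mulr_gt0 // mulrCA [leRHS]mulrC.
  have [E' QE' hE'] := it n; have [_ kE' _] := hQ _ _ QE'.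
  by apply: le_trans kE' _; lra.
apply/le_anti/andP; split=> //; have {}g1 : 1 < g := lt_le_trans p1 pg.
(* The fixed point of E -> g E - c; a start above it, supplied by [hbig], moves away from it by a
   factor of at least [g] each time. *)
pose d := c / (g - 1); have dg : d * (g - 1) = c by rewrite divfK // subr_eq0
  gt_eqF.
have [L [E [QLE dE]]] := hbig d; have [L0 _ kE] := hQ _ _ QLE.
have it n : exists2 E', Q (p ^+ n * L) E' & g ^+ n * (E - d) <= E' - d.
  elim: n => [|n [E' QE' hE']]; first by exists E; rewrite !mul1r.
  have [E'' [QE'' hE'' _]] := hstep _ _ QE'.
  exists E''; first by rewrite exprS -mulrA.
  rewrite exprS -mulrA; apply: le_trans (ler_wpM2l _ hE') _; first by lra.
  by lra.
have d0 : 0 <= d by rewrite divr_ge0 // subr_ge0 ltW.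
have Ed : 0 < E - d by rewrite subr_gt0.
apply: (@le_of_pow_bound _ _ _ (k2 * L / (E - d))) => [||n]; [lra|lra|].
rewrite mulrAC ler_pdivlMr //.
have [E' QE' hE'] := it n; have [_ _ kE'] := hQ _ _ QE'.
by apply: le_trans hE' _; lra.
Qed.

(** At a point between the two intervals [P] would take a value strictly between [i] and [i + 1]. *)
Lemma fibres_adjacent P i ja na jb nb :
  monotone_onto P ->
  (forall k, P k = i <-> ja <= k < ja + na%:Z) ->
  (forall k, P k = i + 1 <-> jb <= k < jb + nb%:Z) ->
  jb = ja + na%:Z.
Proof.
move=> [Pm Ponto] ha hb.
have [k0 /ha k0P] := Ponto i; have [k1 /hb k1P] := Ponto (i + 1).
have Pjb : P jb = i + 1 by apply/hb; lia.
have Pl : P (ja + na%:Z - 1) = i by apply/ha; lia.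
have h1 : ja + na%:Z <= jb.
  by rewrite leNgt; apply/negP => h; have := Pm jb (ja + na%:Z - 1); lia.
apply/le_anti; rewrite h1 andbT leNgt; apply/negP => h2.
have h3 := Pm _ _ h1; have h4 : i <= P (ja + na%:Z) by rewrite -Pl; apply: Pm;
  lia.
have [/ha|] := eqVneq (P (ja + na%:Z)) i; first by lia.
have [/hb|] := eqVneq (P (ja + na%:Z)) (i + 1); first by lia.
by rewrite Pjb in h3; lia.
Qed.

Section Aperiodic.

Variables (A B : finType) (sigma : word_map A A) (varsigma : word_map B B).
Variables K C N : nat.

Local Notation letter := (letter A B C N).
Local Notation rule := (@populated_rule A B sigma varsigma K C N).
Local Notation S := (populated_system sigma varsigma K C N).

Lemma linfty_sorted (w : int -> letter) j n :
  linfty (lang S) w -> sorted (@compatible A B C N) (window w j n).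
Proof.
move/(_ j n) => [v /andP[_ hv] /infixP[s [s' vE]]].
by move: hv; rewrite vE => /cat_sorted2[_ /cat_sorted2[]].
Qed.

Lemma linfty_exponent (w : int -> letter) j :
  linfty (lang S) w -> exponent K (w j) = exponent K (w 0).
Proof.
move=> hw; rewrite /exponent; congr (if _ then _ else _).
apply: (int_const (f := fun j => (w j).1.2)) => k.
have := linfty_sorted k 2 hw; rewrite windowS window1 /= andbT.
by case/andP=> _ /eqP ->.
Qed.

Lemma produces_window (w w' : int -> letter) P j n :
  monotone_onto P -> produces S w w' P ->
  exists vs j' n', all2 rule (window w j n.+1) vs /\
    flatten vs = window w' j' n'.+1.
Proof.
move=> hP hprod.
have rule_pos k i m : (w k, window w' i m) \in rules S -> (0 < m)%N.
  by case: m => // /populated_rulesP /and4P[].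
(* The induction also carries the fibre of the last letter of the window, to which the next fibre is
   adjacent. *)
suff [vs [j' [n' [h1 h2 [jl [nl [h3 h4 h5]]]]]]] : exists vs j' n',
    [/\ all2 rule (window w j n.+1) vs,
        flatten vs = window w' j' n'.+1 & exists jl nl,
        [/\ forall k, P k = j + n%:Z <-> jl <= k < jl + nl%:Z, (0 < nl)%N
          & j' + n'.+1%:Z = jl + nl%:Z]].
  by exists vs, j', n'.
elim: n => [|n [vs [j' [n' [h1 h2 [jl [nl [h3 h4 h5]]]]]]]].
  have [j' [[|n'] [h3 h4]]] := hprod j; first by have := rule_pos _ _ _ h4.
  exists [:: window w' j' n'.+1], j', n'; split.
  - by rewrite window1 /= andbT; apply/populated_rulesP.
  - by rewrite /= cats0.
  by exists j', n'.+1; rewrite addr0.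
have [jr [nr [h6 h7]]] := hprod (j + n.+1%:Z).
have E : j + n.+1%:Z = j + n%:Z + 1 by lia.
have jrE : jr = jl + nl%:Z.
  by apply: (fibres_adjacent hP h3) => k; rewrite -E.
exists (rcons vs (window w' jr nr)), j', (n' + nr)%N; split.
- move: h1; rewrite (windowSr w j n.+1) -!cats1 !all2E => /andP[/eqP sz h1].
  rewrite !size_cat sz eqxx zip_cat // all_cat h1 /= andbT.
  exact/populated_rulesP.
- by rewrite -cats1 flatten_cat /= cats0 h2 -addSn window_add h5 jrE.
by exists jr, nr; split=> //; [exact: rule_pos h7 | rewrite jrE; lia].
Qed.

Variables (lam gam : algR) (la : A -> algR) (lb : B -> algR).
Hypotheses (lam1 : 1 < lam) (gam1 : 1 < gam).
Hypotheses (la0 : forall a, 0 < la a) (lb0 : forall b, 0 < lb b).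
Hypothesis laE : forall a, weight la (sigma a) = lam * la a.
Hypothesis lbE : forall b, weight lb (varsigma b) = gam * lb b.

Definition base_length (u : seq letter) := weight la (map (@base A B C N) u).
Definition load_length (u : seq letter) := weight lb (extend (@load A B C N) u).

Lemma weight_bseq_bound : exists2 c : algR, 0 <= c &
  forall s : N.-bseq B, 0 <= weight lb s <= c.
Proof.
have [m m0 hm] := upper_bound (fun b => ltW (lb0 b)).
exists (m * N%:R) => [|s]; first by rewrite mulr_ge0 // ltW.
rewrite weight_ge0 /=; last by move=> b; apply: ltW.
apply: le_trans (weight_le _ hm) _; rewrite weight_const.
by rewrite ler_wpM2l ?ler_nat ?size_bseq // ltW.
Qed.

Lemma all2_base_length u vs : all2 rule u vs ->
  base_length (flatten vs) = lam * base_length u.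
Proof.
rewrite /base_length; elim: u vs => [|x u IHu] [|v vs] //=.
  by rewrite weight_nil mulr0.
case/andP=> /and4P[_ _ /eqP xv _] /IHu h.
by rewrite map_cat weight_cat h weight_cons mulrDr xv laE.
Qed.

(** Apart from the multiplication, load lengths change only by the flows through the two ends of the
    window, which have bounded length. The error bound thus passes from c' to gam^e c' + c at each
    step, independently of the window. *)
Lemma orbit_steps w P q i : is_orbit S w P ->
  exists2 c : algR, 0 <= c & forall j n, exists j' n',
    let u := window (w i) j n.+1 in let u' := window (w (i + q%:Z)) j' n'.+1 in
    let g := gam ^+ (\sum_(s < q) exponent K (w (i + s%:Z)%R 0%R))%N in
    [/\ base_length u' = lam ^+ q * base_length u,
        g * load_length u - c <= load_length u' &
        load_length u' <= g * load_length u + c].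
Proof.
move=> hw; have [c c0 hc] := weight_bseq_bound.
elim: q => [|q [c' c'0 IHq]].
  exists 0 => // j n; exists j, n => /=.
  by rewrite big_ord0 addr0 !mul1r subr0 addr0.
set e := exponent K (w (i + q%:Z) 0).
have g0 : 0 <= gam ^+ e by rewrite exprn_ge0 // (le_trans ler01) // ltW.
exists (gam ^+ e * c' + c) => [|j n]; first by rewrite addr_ge0 // mulr_ge0.
have [j1 [n1 /=]] := IHq j n; set u1 := window _ _ _; set u := window _ _ _.
set g := gam ^+ _ => -[h1 h2 h3].
have [hlin hP hprod] := hw (i + q%:Z).
have [vs [j' [n' [hvs vsE]]]] := produces_window j1 n1 hP hprod.
exists j', n' => /=; have -> : i + q.+1%:Z = i + q%:Z + 1 by lia.
rewrite -vsE big_ord_recr /= -/e exprD -/g.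
have us := linfty_sorted j1 n1.+1 hlin; have hvs' := hvs.
rewrite windowS in hvs' us; have := congr1 (weight lb) (load_flatten us hvs').
rewrite -windowS linfty_exponent // -/e !weight_cat (weight_iter _ _ lbE).
rewrite -/(load_length _) -/(load_length u1).
set outf := outflow _; set inf := inflow _ => E.
have /andP[o1 o2] := hc outf; have /andP[i1 i2] := hc inf.
have := ler_wpM2l g0 h2; have := ler_wpM2l g0 h3.
rewrite (all2_base_length hvs) h1 exprS mulrA mulrDr mulrBr.
move: E o1 o2 i1 i2; rewrite [g * _]mulrC -!mulrA => E o1 o2 i1 i2 h4 h5.
by split=> //; lra.
Qed.

(** There are finitely many letters, each with a nonempty load, so the ratios of load weight to base
    weight lie between positive constants. *)
Lemma lengths_comparable : exists k1 k2 : algR, 0 < k1 /\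
  forall u, k1 * base_length u <= load_length u <= k2 * base_length u.
Proof.
pose f (x : letter) := weight lb (load x) / la (base x).
have f0 x : 0 < f x.
  rewrite divr_gt0 //; apply: (weight_gt0 (b := x.1.1.2.1)) => [b||] //.
    exact: ltW.
  by rewrite /load mem_head.
have [k1 k10 h1] := positive_lower_bound f0.
have [k2 k20 h2] := upper_bound (fun x => ltW (f0 x)).
exists k1, k2; split=> // u; rewrite /base_length /load_length weight_extend.
have -> : weight la (map (@base A B C N) u) = weight (fun x => la (base x)) u.
  by rewrite /weight big_map.
rewrite [k1 * _]mulr_sumr [k2 * _]mulr_sumr.
apply/andP; split; apply: ler_sum => x _.
  rewrite -ler_pdivlMr //; exact: h1.
by rewrite -ler_pdivrMr //; exact: h2.
Qed.

(** After one period the descendants of a window of row 0 form a window of row 0 again, so the base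
    and load lengths of such windows satisfy the hypotheses of [growth_factors_eq] with factors
    lam^p and gam^d. If [d] were 0, lam^p would be 1. *)
Lemma periodic_commensurate w P : is_orbit S w P -> periodic w P ->
  exists p d, [/\ (1 <= p)%N, (1 <= d)%N & lam ^+ p = gam ^+ d].
Proof.
move=> hw [p p1 hper].
have [c c0 hc] := orbit_steps p 0 hw.
have [k1 [k2 [k10 hk]]] := lengths_comparable.
set d := (\sum_(s < p) _)%N in hc.
have lamp1 : 1 < lam ^+ p by rewrite exprn_egt1 // -lt0n.
have gamd1 : 1 <= gam ^+ d by rewrite exprn_ege1 // ltW.
pose Q L E := exists j n, L = base_length (window (w 0) j n.+1) /\
                          E = load_length (window (w 0) j n.+1).
have E : lam ^+ p = gam ^+ d.
  apply: (@growth_factors_eq _ Q _ _ c k1 k2) => // [L E|L E|b].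
  - move=> [j [n [-> ->]]]; have /andP[-> ->] := hk (window (w 0) j n.+1);
    split=> //.
    rewrite /base_length windowS /= weight_cons ltr_pwDl // weight_ge0 // => a.
    exact: ltW.
  - move=> [j [n [-> ->]]]; have [j' [n' /= [h1 h2 h3]]] := hc j n.
    have wE : window (w 0) j' n'.+1 = window (w (0 + p%:Z)) j' n'.+1.
      by apply: eq_map => k; apply: (hper 0).1.
    exists (load_length (window (w 0) j' n'.+1)); rewrite {2 3}wE; split=> //.
    by exists j', n'; rewrite -h1 -wE.
  have [m m0 hm] := positive_lower_bound lb0.
  have /archi_boundP : 0 <= `|b| / m by rewrite divr_ge0 // ltW.
  set n := Num.bound _; rewrite ltr_pdivrMr // => bn.
  exists (base_length (window (w 0) 0 n.+1)), (load_length (window (w 0) 0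
    n.+1)).
  split; first by exists 0, n.
  apply: le_lt_trans (ler_norm b) _; apply: lt_le_trans bn _.
  apply: le_trans (weight_le _ hm); rewrite weight_const mulrC ler_wpM2l ?(ltW
    m0) //.
  rewrite ler_nat; apply: leq_trans (leqnSn n) _.
  rewrite -[leqLHS](size_window (w 0) 0).
  exact: (size_extend_ge (load_map A B C N)).
exists p, d; split=> //; rewrite lt0n; apply: contraTneq lamp1 => d0.
by rewrite E d0 expr0 ltxx.
Qed.

End Aperiodic.

(** * Existence of orbits *)

Lemma int_threshold (P : pred int) lo hi :
  ~~ P lo -> P hi -> lo <= hi -> exists m, P m && ~~ P (m - 1).
Proof.
move=> Plo Phi le; have hiE : hi = lo + (absz (hi - lo)%R)%:Z by lia.
move: Phi; rewrite hiE; elim: (absz _) => [|n IHn];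
  first by rewrite addr0 (negPf Plo).
have [/IHn //|nPn] := boolP (P (lo + n%:Z)).
by move=> h; exists (lo + n.+1%:Z); rewrite h -addn1 PoszD addrA addrK.
Qed.

Lemma int_increasing (R : numDomainType) (f : int -> R) :
  (forall k, f k < f (k + 1)) -> {homo f : x y / x < y}.
Proof.
move=> h x y xy; have -> : y = x + (absz (y - x - 1)%R)%:Z + 1 by lia.
elim: (absz _) => [|n IHn]; first by rewrite addr0.
by apply: lt_trans IHn _; rewrite -[n.+1]addn1 PoszD [x + (_ + _)]addrA.
Qed.

Lemma int_slope_ge (R : numDomainType) (f : int -> R) c :
  (forall k, f k + c <= f (k + 1)) -> forall k n, f k + c * n%:R <= f (k +
    n%:Z).
Proof.
move=> h k; elim=> [|n IHn]; first by rewrite mulr0 !addr0.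
rewrite -addn1 PoszD addrA; apply: le_trans (h _).
by rewrite natrD mulrDr mulr1 addrA lerD2r.
Qed.

(** Integer steps are at least 1, so [f] is unbounded in both directions. *)
Lemma int_floor (f : int -> int) : f 0 = 0 -> (forall k, f k < f (k + 1)) ->
  forall j, exists k, (f k <= j) && (j < f (k + 1)).
Proof.
move=> f0 h j; have hf := @int_slope_ge int f 1.
have {}hf k n : f k + n%:Z <= f (k + n%:Z).
  by have := hf _ k n; rewrite mul1r natz; apply=> i; have := h i; lia.
have [||//|m] := @int_threshold (fun m => j < f m) (- (absz j)%:Z) ((absz j)%:Z
  + 1).
- by have := hf (- (absz j)%:Z) (absz j); rewrite addNr f0; lia.
- have := hf 0 (absz j).+1; rewrite f0 add0r; have <- : (absz j)%:Z + 1 = (absz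
  j).+1%:Z by lia.
  by lia.
- by lia.
by move=> hm; exists (m - 1); rewrite subrK leNgt andbC.
Qed.

Lemma int_floor_unique (f : int -> int) (h : forall k, f k < f (k + 1)) j k l :
  (f k <= j) && (j < f (k + 1)) -> (f l <= j) && (j < f (l + 1)) -> k = l.
Proof.
move=> hk hl; apply/eqP; rewrite eq_le !leNgt; apply/andP; split;
  apply/negP => lt.
  have [/(int_increasing h)|E] : l + 1 < k \/ l + 1 = k by lia.
    by lia.
  by rewrite E in hl; lia.
have [/(int_increasing h)|E] : k + 1 < l \/ k + 1 = l by lia.
  by lia.
by rewrite E in hk; lia.
Qed.

(** * Orbits from two rows with matched boundaries *)

Section OrbitOfComparison.

Variables (A B : finType) (sigma : word_map A A) (varsigma : word_map B B).
Variables K C N : nat.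

Variables (wA : int -> int -> A) (a : int -> int -> int).
Variables (wB : int -> int -> B) (b : int -> int -> int) (bit : int -> bool).
Let e (i : int) := if bit i then K else (K - 1)%N.
Hypothesis aE : forall i, inflates sigma (wA i) (wA (i + 1)) (a i).
Hypothesis bE : forall i,
  inflates (fun c => iter (e i) (extend varsigma) [:: c]) (wB i) (wB (i + 1)) (b
    i).

(* The letters of [wB i] with indices in [[F i k, F i (k + 1))] are carried by
   the [k]-th letter of [wA i]. *)
Variable F : int -> int -> int.
Hypothesis F0 : forall i, F i 0 = 0.
Hypothesis F_lt : forall i k : int, F i k < F i (k + 1).
Hypothesis F_le : forall i k : int, F i (k + 1) <= F i k + C.+1%:Z.
Hypothesis F_image : forall i k,
  F (i + 1) (a i k) <= b i (F i k) <= F (i + 1) (a i k) + N%:Z.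

Local Notation letter := (letter A B C N).

(** The letters between the new boundary and the image of the old one, which pass rightwards. By
    [F_image] the difference is nonnegative and at most [N], so neither [absz] nor the default of
    [insub_bseq] distorts it. *)
Let flow (i k : int) : N.-bseq B :=
  insub_bseq N (window (wB (i + 1)) (F (i + 1) (a i k))
    (absz (b i (F i k) - F (i + 1) (a i k))%R)).

Let w (i k : int) : letter :=
  (wA i k,
   (wB i (F i k),
    insub_bseq C
      (window (wB i) (F i k + 1) (absz (F i (k + 1) - F i k - 1)%R))),
   bit i, (flow i k, flow i (k + 1))).

Lemma load_inflates i : inflates (fun x : letter => load x) (w i) (wB i) (F i).
Proof.
split=> // k; have hlt := F_lt i k; have hle := F_le i k.
have lE : load (w i k) = window (wB i) (F i k) (absz (F i (k + 1) - F i k)%R).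
  rewrite /load /= /insub_bseq val_insubd size_window ifT; last first.
    by move: hlt hle; set v := F i (k + 1); lia.
  rewrite -windowS; congr (window _ _ _).
  by move: hlt; set v := F i (k + 1); lia.
rewrite lE size_window; split=> //.
by move: hlt; set v := F i (k + 1); lia.
Qed.

Lemma flowE i k : flow i k = window (wB (i + 1)) (F (i + 1) (a i k))
    (absz (b i (F i k) - F (i + 1) (a i k))%R) :> seq B.
Proof.
rewrite /flow /insub_bseq val_insubd size_window ifT //.
have := F_image i k; set u := F _ (a i k); lia.
Qed.

Lemma compatible_window i j n : sorted (@compatible A B C N) (window (w i) j n).
Proof.
case: n => // n; rewrite windowS /=; elim: n j => // n IHn j.
by rewrite windowS /= IHn andbT /compatible /= !eqxx.
Qed.

Lemma a_lt i k : a i k < a i (k + 1).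
Proof.
have [_ /(_ k)[-> _]] := aE i.
by case: (sigma _) (@word_of_neq0 _ _ sigma (wA i k)) => //= ? ? _; lia.
Qed.

(** Both sides of the conservation law are the stretch of [wB (i + 1)] from [F (i + 1) (a i k)] to
    [b i (F i (k + 1))]. *)
Lemma window_rule i k : populated_rule sigma varsigma K (w i k)
  (window (w (i + 1)) (a i k) (size (sigma (wA i k)))).
Proof.
have [_ /(_ k)[aS aW]] := aE i; apply/and4P; split.
- by have := @word_of_neq0 _ _ sigma (wA i k); rewrite -aW; case: size.
- exact: compatible_window.
- by rewrite map_window [window _ _ _]aW.
have [F1 W1] := inflates_window (a i k) (size (sigma (wA i k))) (load_inflates
  (i + 1)).
have [_ /(_ k)[F2 W2]] := load_inflates i.
have [b1 W3] := inflates_window (F i k) (size (load (w i k))) (bE i).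
rewrite W2 -iter_extend in b1 W3.
rewrite /outflow /inflow /= !flowE -W1 -[iter _ _ _]W3 -aS in F1 *.
have h1 := F_image i k; have h2 := F_image i (k + 1).
move: W1 W3 b1 F1; set n1 := size (extend _ _); set n2 := size (iter _ _ _).
move=> _ _ b1 F1.
move: h1 h2 F1; rewrite F2 b1; set x := F _ (a i k); set y := F _ (a i (k + 1)).
set z := b i (F i k) => h1 h2 F1.
have zE : z = x + (absz (z - x)%R)%:Z by lia.
rewrite size_window in F1; rewrite [in X in _ == _ ++ X]zE.
by rewrite F1 -!window_add; apply/eqP; congr (window _ _ _); lia.
Qed.

Lemma orbit_of_comparison :
  exists w P, is_orbit (populated_system sigma varsigma K C N) w P.
Proof.
have h i j : exists k, (a i k <= j) && (j < a i (k + 1)).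
  exact: int_floor (aE i).1 (a_lt i) j.
exists w, (fun i j => xchoose (h i j)) => i; split.
- move=> j n; exists (window (w i) j n.+1).
    by apply/andP; split; last exact: compatible_window.
  by rewrite windowSr -cats1 prefix_infix ?prefix_prefix.
- pose p j := xchoose (h i j); rewrite -/p.
  have pP j : (a i (p j) <= j) && (j < a i (p j + 1)) by apply: xchooseP (h i
    j).
  split=> [x y xy|k]; last first.
    have ak : (a i k <= a i k) && (a i k < a i (k + 1)) by rewrite lexx a_lt.
    by exists (a i k); exact: (int_floor_unique (a_lt i) (pP (a i k)) ak).
  rewrite leNgt; apply/negP => yx; have := pP x; have := pP y.
  have [/(int_increasing (a_lt i))|] : p y + 1 < p x \/ p y + 1 = p x by lia.
    by set u := a i (p y + 1); set v := a i (p x); lia.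
  by move=> <-; set u := a i (p y + 1); lia.
move=> k; exists (a i k), (size (sigma (wA i k))); split; last first.
  exact/populated_rulesP/window_rule.
move=> j; have [_ /(_ k)[<- _]] := aE i; have pj := xchooseP (h i j).
by split=> [<- //|]; exact: (int_floor_unique (a_lt i) pj).
Qed.

End OrbitOfComparison.

(** * Coordinates of letters along a row *)

Section Position.

Variables (R : zmodType).

(** The discrete primitive of [f] vanishing at 0: when [f] gives the lengths of the letters, this is
    the coordinate of the left end of letter [k]. *)
Definition position (f : int -> R) (k : int) : R :=
  match k with
  | Posz n => \sum_(j < n) f (Posz j)
  | Negz n => - \sum_(j < n.+1) f (Negz j)
  end.

Lemma position0 f : position f 0 = 0.
Proof. by rewrite /= big_ord0. Qed.

Lemma positionS f k : position f (k + 1) = position f k + f k.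
Proof.
case: k => [n|[|n]]; first by rewrite -PoszD addn1 /= big_ord_recr.
  by rewrite /= big_ord0 big_ord_recr big_ord0 /= add0r addNr.
have -> : Negz n.+1 + 1 = Negz n by lia.
by rewrite /= [in RHS]big_ord_recr /= opprD subrK.
Qed.

Lemma position_window (A : Type) (l : A -> R) (w : int -> A) k n :
  position (fun j => l (w j)) (k + n%:Z) =
  position (fun j => l (w j)) k + weight l (window w k n).
Proof.
elim: n => [|n IHn]; first by rewrite addr0 weight_nil addr0.
rewrite windowSr -cats1 weight_cat weight_seq1 addrA -IHn -positionS.
by congr position; lia.
Qed.

End Position.

(** Both sides vanish at 0 and have the same increments from [k] to [k + 1]. *)
Lemma position_inflates (R : pzRingType) (A B : Type) (f : A -> seq B) w w' a
    (l : A -> R) (l' : B -> R) c :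
  inflates f w w' a -> (forall x, weight l' (f x) = c * l x) ->
  forall k, position (fun j => l' (w' j)) (a k) =
            c * position (fun j => l (w j)) k.
Proof.
move=> [a0 h] hl k; apply/eqP; rewrite -subr_eq0; apply/eqP.
pose d k := position (fun j => l' (w' j)) (a k) - c * position (fun j => l (w
  j)) k.
rewrite -/(d k) (int_const (f := d)); first by rewrite /d a0 !position0 mulr0
  subr0.
move=> {}k; rewrite /d; have [-> hw] := h k.
by rewrite position_window hw hl positionS mulrDr opprD addrACA subrr addr0.
Qed.

Fixpoint boundary_iter (b : int -> int -> int) (d : int) (n : nat) (k : int) :=
  if n is m.+1 then b (d + m%:Z) (boundary_iter b d m k) else k.

Lemma inflates_iter (B : Type) (s : B -> seq B) w b :
  (forall d, inflates s (w d) (w (d + 1)) (b d)) ->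
  forall d n, inflates (fun c => iter n (extend s) [:: c]) (w d) (w (d + n%:Z))
    (boundary_iter b d n).
Proof.
move=> h d; elim=> [|n IHn]; first by rewrite addr0; apply: inflates_id.
by have := inflates_comp IHn (h _); rewrite -addrA -PoszD addn1.
Qed.

Lemma real_threshold (R : archiRealFieldType) (f : int -> R) c :
  f 0 = 0 -> 0 < c -> (forall k, f k + c <= f (k + 1)) ->
  forall t, exists m, (t <= f m) && ~~ (t <= f (m - 1)).
Proof.
move=> f0 c0 hf t; have hs := int_slope_ge hf.
have /archi_boundP : 0 <= (`|t| + 1) / c by rewrite divr_ge0 ?addr_ge0 // ltW.
set n := Num.bound _; rewrite ltr_pdivrMr // mulrC => hn.
have t1 : t <= `|t| by apply: ler_norm.
have t2 : - `|t| <= t by rewrite lerNl -normrN ler_norm.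
have [||//|m hm] := @int_threshold (fun m => t <= f m) (- n%:Z) n%:Z.
- by have := hs (- n%:Z) n; rewrite addNr f0 -ltNge; lra.
- by have := hs 0 n; rewrite f0 !add0r; lra.
by exists m.
Qed.

(** * Two rows kept at bounded relative scale *)

Section Comparison.

Variables (A B : finType) (sigma : word_map A A) (varsigma : word_map B B).
Variables (lam gam : algR) (la : A -> algR) (lb : B -> algR).
Hypotheses (lam1 : 1 < lam) (gam1 : 1 < gam).
Hypotheses (la0 : forall a, 0 < la a) (lb0 : forall b, 0 < lb b).
Hypothesis laE : forall a, weight la (sigma a) = lam * la a.
Hypothesis lbE : forall b, weight lb (varsigma b) = gam * lb b.

Lemma least_exponent (i : int) :
  exists d : int, (lam ^ i <= gam ^ d) && ~~ (lam ^ i <= gam ^ (d - 1)).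
Proof.
have l0 : 0 < lam ^ i by rewrite exprz_gt0 // (lt_trans ltr01).
have [n hn] := pow_unbounded gam1 (ltW l0).
have il0 : 0 <= (lam ^ i)^-1 by rewrite invr_ge0 ltW.
have [m hm] := pow_unbounded gam1 il0.
apply: (@int_threshold (fun d => lam ^ i <= gam ^ d) (- m%:Z) n%:Z);
  last by lia.
  rewrite -ltNge -invr_expz -[ltRHS]invrK ltf_pV2 ?posrE ?invr_gt0 //.
  by rewrite exprz_gt0 // (lt_trans ltr01).
exact: ltW.
Qed.

(** With theta = log lam / log gam, this is the ceiling of i theta, and [K] below is that of
    theta. *)
Let D (i : int) : int := xchoose (least_exponent i).

Let D_ge i : lam ^ i <= gam ^ (D i).
Proof. by have /andP[] := xchooseP (least_exponent i). Qed.

Let D_lt i : gam ^ (D i - 1) < lam ^ i.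
Proof. by have /andP[_] := xchooseP (least_exponent i); rewrite -ltNge. Qed.

Let lam0 : 0 < lam. Proof. exact: lt_trans lam1. Qed.
Let gam0 : 0 < gam. Proof. exact: lt_trans gam1. Qed.

Let K := absz (D 1).

Let D1 : D 1 = K%:Z /\ (1 <= K)%N.
Proof.
suff : 0 < D 1 by rewrite /K; lia.
rewrite -(ltr_eXz2l gam1) expr0z; apply: lt_le_trans (D_ge 1).
by rewrite expr1z.
Qed.

Let bit (i : int) : bool := D (i + 1) == D i + K%:Z.
Let e (i : int) := if bit i then K else (K - 1)%N.

(** The ceiling of (i + 1) theta is at most the sum of the ceilings of i theta and theta, and more
    than that sum minus 2. *)
Let D_step (i : int) : D (i + 1) = D i + (e i)%:Z.
Proof.
have [D1E K1] := D1.
have h1 : D (i + 1) - 1 < D i + K%:Z.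
  rewrite -(ltr_eXz2l gam1); apply: lt_le_trans (D_lt _) _.
  rewrite !expfzDr ?gt_eqF // -D1E.
  by apply: ler_pM; rewrite ?D_ge // ltW // exprz_gt0.
have h2 : D i - 1 + (K%:Z - 1) < D (i + 1).
  rewrite -(ltr_eXz2l gam1); apply: lt_le_trans (D_ge _).
  rewrite expfzDr ?gt_eqF // [lam ^ _]expfzDr ?gt_eqF // -D1E.
  by apply: ltr_pM; rewrite ?D_lt // ltW // exprz_gt0.
have [h|h] := boolP (bit i); last first.
  rewrite /e (negPf h); move: h h1 h2; rewrite /bit; set u := D (i + 1).
  by move=> /eqP; lia.
by rewrite /e h; apply/eqP.
Qed.

Variables (wA : int -> int -> A) (a : int -> int -> int).
Variables (wB : int -> int -> B) (b : int -> int -> int).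
Hypothesis aE : forall i, inflates sigma (wA i) (wA (i + 1)) (a i).
Hypothesis bE : forall d, inflates varsigma (wB d) (wB (d + 1)) (b d).

Let bb i := boundary_iter b (D i) (e i).

Let bbE i : inflates (fun c => iter (e i) (extend varsigma) [:: c])
  (wB (D i)) (wB (D (i + 1))) (bb i).
Proof. by rewrite D_step; apply: inflates_iter. Qed.

(* The rescaling of the boundary positions makes the productions preserve
   them. *)
Let x i k : algR := position (fun j => la (wA i j)) k * lam ^ (- i).
Let y i m : algR := position (fun j => lb (wB (D i) j)) m * gam ^ (- D i).

Let x_image i k : x (i + 1) (a i k) = x i k.
Proof.
rewrite /x (position_inflates (aE i) laE) opprD expfzDr ?gt_eqF // exprN1.
by rewrite mulrACA mulrCA -mulrA [lam * _]mulrCA; field; rewrite gt_eqF.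
Qed.

Let y_image i m : y (i + 1) (bb i m) = y i m.
Proof.
have wE c : weight lb (iter (e i) (extend varsigma) [:: c]) = gam ^+ e i * lb c.
  by rewrite (weight_iter _ _ lbE) weight_seq1.
rewrite /y (position_inflates (bbE i) wE) D_step opprD expfzDr ?gt_eqF //.
rewrite -(invr_expz gam (e i)) -exprnP; set p := position _ _;
  set g := gam ^+ _.
by field; rewrite expf_neq0 // gt_eqF.
Qed.

(** The choice of [D] keeps the ratio of lam^(-i) to gam^(-D i) between 1 and [gam], so loads and
    flows are bounded uniformly in [i]. *)
Lemma comparison_orbit : exists K C N : nat, (1 <= K)%N /\
  exists w P, is_orbit (populated_system sigma varsigma K C N) w P.
Proof.
have [ma ma0 hma] := positive_lower_bound la0.
have [Ma Ma0 hMa] := upper_bound (fun c => ltW (la0 c)).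
have [mb mb0 hmb] := positive_lower_bound lb0.
have [Mb Mb0 hMb] := upper_bound (fun c => ltW (lb0 c)).
(* Stretching by [s] makes every letter of [A] at least as long as any letter of [B], so that each
   carries at least one. *)
pose s := Mb / ma; have s0 : 0 < s by rewrite divr_gt0.
have g0 i : 0 < gam ^ (- D i) by rewrite exprz_gt0.
have h0 i : 0 < lam ^ (- i) by rewrite exprz_gt0.
have gh i : gam ^ (- D i) <= lam ^ (- i).
  by rewrite -!invr_expz lef_pV2 ?posrE ?exprz_gt0.
have hg i : lam ^ (- i) < gam * gam ^ (- D i).
  have -> : gam * gam ^ (- D i) = (gam ^ (D i - 1))^-1.
    rewrite expfzDr ?gt_eqF // exprN1 -invr_expz; field.
    by rewrite !gt_eqF ?exprz_gt0.
  by rewrite -invr_expz ltf_pV2 ?posrE ?exprz_gt0.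
have y0 i : y i 0 = 0 by rewrite /y position0 mul0r.
have yS i m : y i (m + 1) = y i m + lb (wB (D i) m) * gam ^ (- D i).
  by rewrite /y positionS mulrDl.
have xS i k : x i (k + 1) = x i k + la (wA i k) * lam ^ (- i).
  by rewrite /x positionS mulrDl.
have y_lb i m : y i m + mb * gam ^ (- D i) <= y i (m + 1).
  by rewrite yS lerD2l ler_wpM2r ?hmb // ltW.
have y_lt i : {mono y i : u v / u <= v}.
  apply/le_mono/int_increasing => m; apply: lt_le_trans (y_lb i m).
  by rewrite ltrDl mulr_gt0.
have thr i k := real_threshold (y0 i) (mulr_gt0 mb0 (g0 i)) (y_lb i) (s * x i
  k).
(* The first letter of [B] that starts at or after the left end of the k-th letter of [A]. *)
pose F i k := xchoose (thr i k).
have F_ge i k : s * x i k <= y i (F i k) by have /andP[] := xchooseP (thr i k).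
have F_pred i k : y i (F i k - 1) < s * x i k.
  by have /andP[_] := xchooseP (thr i k); rewrite -ltNge.
(* In units of gam^(-D i), a stretched letter of [A] has length at most s Ma gam, and a letter of
   [B] at least [mb]. *)
have [C hC] : exists C : nat, s * Ma * gam / mb < C%:R.
  exists (Num.bound (s * Ma * gam / mb)); apply: archi_boundP.
  by rewrite ltW // divr_gt0 ?mulr_gt0 ?invr_gt0.
pose N := \max_c size (iter K (extend varsigma) [:: c]).
exists K, C, N; split; first by case: D1.
apply: (@orbit_of_comparison A B sigma varsigma K C N wA a
  (fun i => wB (D i)) bb bit aE bbE F).
- move=> i; have := F_ge i 0; have := F_pred i 0.
  have -> : s * x i 0 = y i 0 by rewrite y0 /x position0 mul0r mulr0.
  rewrite y_lt (leW_mono (y_lt i)).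
  by lia.
- move=> i k; rewrite ltNge; apply/negP; rewrite -(y_lt i) => hF.
  have h1 := F_ge i (k + 1); have h2 := F_pred i k.
  have h3 := yS i (F i k - 1); rewrite subrK in h3.
  have h4 : lb (wB (D i) (F i k - 1)) * gam ^ (- D i) <= Mb * gam ^ (- D i).
    by rewrite ler_wpM2r ?hMb // ltW.
  have h5 : Mb * gam ^ (- D i) <= s * (la (wA i k) * lam ^ (- i)).
    rewrite mulrA; apply: ler_pM; rewrite ?gh ?(ltW Mb0) ?(ltW (g0 i)) //.
    by rewrite /s -mulrA ler_peMr ?(ltW Mb0) // mulrC ler_pdivlMr // mul1r.
  by rewrite xS mulrDr in h1; lra.
- move=> i k; rewrite leNgt; apply/negP => hF.
  have {hF} hF : F i k + C.+1%:Z <= F i (k + 1) - 1.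
    by move: hF; set v := F i (k + 1); lia.
  rewrite -(y_lt i) in hF; have h1 := int_slope_ge (y_lb i) (F i k) C.+1.
  have h2 := F_pred i (k + 1); have h3 := F_ge i k.
  have h4 : s * (la (wA i k) * lam ^ (- i)) <= s * (Ma * (gam * gam ^ (- D i))).
    by rewrite ler_wpM2l ?(ltW s0) // ler_pM ?hMa // ltW ?hg.
  rewrite xS mulrDr in h2.
  have h5 : s * Ma * gam * gam ^ (- D i) <= mb * gam ^ (- D i) * C%:R.
    by rewrite [leRHS]mulrAC ler_wpM2r ?(ltW (g0 i)) // [leRHS]mulrC
      -ler_pdivrMr // ltW.
  have h6 : 0 < mb * gam ^ (- D i) by rewrite mulr_gt0.
  rewrite -natr1 mulrDr mulr1 in h1.
  have h7 : s * (Ma * (gam * gam ^ (- D i))) = s * Ma * gam * gam ^ (- D i) by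
    ring.
  by lra.
move=> i k; apply/andP; split.
  rewrite leNgt; apply/negP => lt.
  have : bb i (F i k) <= F (i + 1) (a i k) - 1.
    by move: lt; set u := F (i + 1) _; lia.
  rewrite -(y_lt (i + 1)) y_image => h1.
  have := F_pred (i + 1) (a i k); rewrite x_image => h2.
  by have := F_ge i k; lra.
(* The image of the last letter of [B] before the boundary starts before the new boundary, so the
   overshoot is at most the size of that image, hence at most [N]. *)
have h1 : bb i (F i k - 1) < F (i + 1) (a i k).
  rewrite -(leW_mono (y_lt (i + 1))) y_image; apply: lt_le_trans (F_pred i k) _.
  by rewrite -(x_image i k).
have [_ /(_ (F i k - 1))[h2 _]] := bbE i; rewrite subrK in h2; rewrite h2.
set c := wB _ _ in h2 *.
have h3 : (size (iter (e i) (extend varsigma) [:: c]) <= N)%N.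
  apply: leq_trans (leq_bigmax c); apply: size_iter_mono.
  by rewrite /e; case: ifP => // _; rewrite leq_subr.
by move: h1; set u := F (i + 1) (a i k); lia.
Qed.

End Comparison.

Theorem lemma3 (A B : finType) (sigma : word_map A A)
  (varsigma : word_map B B)
  (hA : (0 < #|A|)%N) (hB : (0 < #|B|)%N)
  (sigma_prim : primitive sigma)
  (sigma_exp : expansive (substitution_system sigma))
  (varsigma_prim : primitive varsigma)
  (varsigma_exp : expansive (substitution_system varsigma)) :
  exists (K N : nat) (AB : finType) (S : production_system AB)
         (alpha : AB -> A) (beta : word_map AB B) (delta : AB -> nat),
    [/\ (1 <= K)%N, (1 <= N)%N, regular (lang S) &
        forall a, delta a = K \/ delta a = (K - 1)%N] /\
    [/\ (* 1 *)
        forall w P, is_orbit S w P ->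
          is_orbit (substitution_system sigma) (fun i j => alpha (w i j)) P,
        (* 2 *)
        forall w, lang S w ->
          forall a b, a \in w -> b \in w -> delta a = delta b,
        (* 3 *)
        forall w w', rewrites S w w' ->
          forall a, a \in w ->
            approx N (extend beta w')
                     (iter (delta a) (extend varsigma) (extend beta w)),
        (* 4 *)
        forall lambda gamma : algC,
          growth_rate sigma lambda -> growth_rate varsigma gamma ->
          incommensurate lambda gamma ->
          forall w P, is_orbit S w P -> ~ periodic w P
      & (* 5 *)
        exists w P, is_orbit S w P].
Proof.
have [lam [la [lam1 la0 laE lamU]]] := perron_frobenius hA sigma_prim sigma_exp.
have [gam [lb [gam1 lb0 lbE gamU]]] := perron_frobenius hB varsigma_prim
  varsigma_exp.
have [wA [a aE]] := rows_exist hA sigma_exp.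
have [wB [b bE]] := rows_exist hB varsigma_exp.
have [K [C [N [K1 orb]]]] := comparison_orbit lam1 gam1 la0 lb0 laE lbE aE bE.
exists K, N.+1, (letter A B C N), (populated_system sigma varsigma K C N),
  (@base A B C N), (load_map A B C N), (@exponent A B K C N).
split; split=> //.
- exact: populated_regular.
- by move=> x; rewrite /exponent; case: ifP; [left | right].
- exact: populated_orbit_base.
- by move=> w hw x y; apply: exponent_const.
- exact: populated_approx.
move=> lambda gamma hl hg inc w P hw hP; apply: inc.
have [p [d [p1 d1 pd]]] :=
  periodic_commensurate lam1 gam1 la0 lb0 laE lbE hw hP.
exists p, d; split=> //.
by rewrite (lamU _ hl) (gamU _ hg) -!rmorphXn pd.
Qed.
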